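(* Consider the two equations in $(a,c)$ $$(3125a^6-7500a^5+4800a^4-112a^3-96a^2+1536a-1024)\,c+93312=0\quad(E_1),\qquad a^4(a-1)^3c^2-432=0\quad(E_2),$$ which express that the critical points of $p(z)=c\,z^3(z-1)^2(z-a)$ at the two roots $u,v$ of $6z^2-(4+5a)z+3a$ satisfy $p(u)=p(v)=1$. (1) Eliminating $c$ gives $$\mathrm{Res}_c(E_1,E_2)=-432\,(25a^2-32a+16)^3\,(25a^3-12a^2-24a-16)^2 .$$ (2) The passport $\langle(3,2,1),(2,2,1,1),(6)\rangle$ corresponds exactly to the cubic factor: it contains exactly three plane trees $T_1,T_2,T_3$, forming a single $G_{\mathbb{Q}}$-orbit, indexed by the three roots $a_1,a_2,a_3$ of the irreducible cubic $25a^3-12a^2-24a-16=0$ (the tree $T_i$ being the dessin of $p(z)=c_i\,z^3(z-1)^2(z-a_i)$ with $c_i$ determined by $a_i$ through $(E_1)$). (3) The field of moduli of $T_i$ is the embedded cubic field $\mathbb{Q}(a_i)\subset\mathbb{C}$, which is also a field of definition for it. The three fields $\mathbb{Q}(a_1),\mathbb{Q}(a_2),\mathbb{Q}(a_3)$ are distinct subfields of $\mathbb{C}$, the conjugate embeddings of one abstract non-Galois cubic field, abstractly isomorphic to $\mathbb{Q}(\sqrt[3]{2})$, and they are permuted by $G_{\mathbb{Q}}$ along with the trees: writing $M(T)$ for the field of moduli, $M(T^\sigma)=\sigma(M(T))$ for $\sigma\in G_{\mathbb{Q}}$ and $T\in\{T_1,T_2,T_3\}$. (4) Explicitly, the real root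 is $$a=\frac{4+18\sqrt[3]{2}+6\sqrt[3]{4}}{25}\approx 1.448119408,$$ and the corresponding Belyi polynomial is $c\,z^3(z-1)^2(z-a)$ with $$c=\frac{-78125}{1968\sqrt[3]{2}+681\sqrt[3]{4}-1196}\approx-33.040186803 .$$
   Context: $G_{\mathbb{Q}}=\mathrm{Gal}(\overline{\mathbb{Q}}/\mathbb{Q})$, with $\overline{\mathbb{Q}}\subset\mathbb{C}$. A Belyi map is a non-constant morphism $t\colon X\to\mathbb{P}^1$ from a smooth projective connected curve over $\mathbb{C}$ branched only over $\{0,1,\infty\}$; isomorphisms commute with the maps to $\mathbb{P}^1$. Its dessin is the bipartite graph $t^{-1}([0,1])$ embedded in $X$, with black vertices $t^{-1}(0)$ and white vertices $t^{-1}(1)$; the passport is the triple of partitions of $\deg t$ given by ramification indices over $0,1,\infty$. Plane trees with $d$ edges (bipartitely coloured, up to isomorphism of oriented embedded graphs) are exactly the dessins of polynomial Belyi maps of degree $d$ on $\mathbb{P}^1$, which are determined up to affine substitution $z\mapsto\alpha z+\beta$. In $p(z)=c\,z^3(z-1)^2(z-a)$ the black vertices of degrees $3,2,1$ are at $0,1,a$. $G_{\mathbb{Q}}$ acts on isomorphism classes of dessins by applying $\sigma$ to the coefficients of a model of $(X,t)$ over $\overline{\mathbb{Q}}$, $T\mapsto T^\sigma$; this preserves passports. The field of moduli $M(T)$ of a dessin $T$ is the fixed field in $\overline{\mathbb{Q}}$ of its stabilizer in $G_{\mathbb{Q}}$ (equivalently the fixed field in $\mathbb{C}$ of $\{\sigma\in\mathrm{Aut}(\mathbb{C}):(X^\sigma,t^\sigma)\cong(X,t)\}$).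 A field of definition is a field $K\subseteq\mathbb{C}$ such that $(X,t)$ is isomorphic to the base change of a curve and map over $K$. *)

(* Defs.v *)
From HB Require Import structures.
From mathcomp Require Import all_boot all_order all_algebra all_fingroup all_field.
From mathcomp Require Import complex.
From mathcomp Require Import all_classical all_reals all_analysis.

Set Implicit Arguments.
Unset Strict Implicit.
Unset Printing Implicit Defensive.

Import Order.TTheory GRing.Theory Num.Theory.

Local Open Scope classical_set_scope.
Local Open Scope ring_scope.
Local Open Scope complex_scope.

Definition algebraic_number (R : realType) : {pred R[i]} :=
  fun z => `[< algebraicOver (ratr : rat -> R[i]) z >].

Fact algebraic_number_divring (R : realType) :
  divring_closed (@algebraic_number R).
Proof.
split=> [|x y /asboolP Qx /asboolP Qy|x y /asboolP Qx /asboolP Qy]; apply/asboolP.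
- exact: algebraic1.
- exact: algebraic_sub.
- exact: algebraic_div.
Qed.

HB.instance Definition _ (R : realType) :=
  GRing.isDivringClosed.Build R[i] (@algebraic_number R)
    (@algebraic_number_divring R).

(* The algebraic closure of the rationals inside the complex numbers, as a
   field in its own right; [val] is the inclusion. *)
Record Qbar (R : realType) := MkQbar {
  Qbar_val : R[i];
  Qbar_valP : Qbar_val \in @algebraic_number R }.

HB.instance Definition _ (R : realType) := [isSub for @Qbar_val R].
HB.instance Definition _ (R : realType) := [Choice of Qbar R by <:].
HB.instance Definition _ (R : realType) :=
  [SubChoice_isSubIntegralDomain of Qbar R by <:].
HB.instance Definition _ (R : realType) :=
  [SubIntegralDomain_isSubField of Qbar R by <:].

Record absGal (R : realType) := AbsGal {
  absGal_fun :> {rmorphism Qbar R -> Qbar R};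
  absGal_bij : bijective absGal_fun }.

Definition is_subfield (R : realType) (K : set R[i]) : Prop :=
  [/\ K 1, forall x y, K x -> K y -> K (x - y)
         & forall x y, K x -> K y -> K (x / y)].

Definition Qadjoin (R : realType) (x : R[i]) : set R[i] :=
  smallest (@is_subfield R) [set x].

(* Infinity is always a branch point of a polynomial of degree at least 2 and
   is allowed anyway, so only the finite critical values are constrained. *)
Definition belyi_poly (R : realType) (p : {poly R[i]}) : Prop :=
  (1 < size p)%N /\ forall z, root (deriv p) z -> p.[z] = 0 \/ p.[z] = 1.

(* An isomorphism of P^1 commuting with two polynomial maps fixes infinity,
   hence is an affine substitution. *)
Definition belyi_iso (R : realType) (p q : {poly R[i]}) : Prop :=
  exists u v : R[i], u != 0 /\ q = p \Po (u *: 'X + v%:P).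

(* Dessins are identified with isomorphism classes of Belyi maps; a class of
   polynomial Belyi maps is a plane tree, with black vertices over 0 and white
   vertices over 1. *)
Definition dessin (R : realType) (p : {poly R[i]}) : set {poly R[i]} :=
  [set q | belyi_iso p q].

(* Ramification indices of p over the finite point y, in decreasing order. *)
Definition ramification (R : realType) (p : {poly R[i]}) (y : R[i]) : seq nat :=
  let q := p - y%:P in
  sort geq [seq mup z q | z <- undup (sval (closed_field_poly_normal q))].

(* The partitions over 0, 1 and infinity; a polynomial is totally ramified over
   infinity. *)
Definition passport (R : realType) (p : {poly R[i]}) :
    seq nat * seq nat * seq nat :=
  (ramification p 0, ramification p 1, [:: (size p).-1]).

Definition trees_with_passport (R : realType)
    (pi : seq nat * seq nat * seq nat) : set (set {poly R[i]}) :=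
  [set T | exists p : {poly R[i]},
     [/\ belyi_poly p, passport p = pi & T = dessin p]].

(* T^s : pick a model of T with coefficients in Qbar, apply s to them, and
   take the isomorphism class. *)
Definition conj_tree (R : realType) (s : absGal R) (T : set {poly R[i]}) :
    set {poly R[i]} :=
  [set q | exists p : {poly Qbar R},
     T (map_poly val p) /\ dessin (map_poly val (map_poly s p)) q].

Definition galois_orbit (R : realType) (T : set {poly R[i]}) :
    set (set {poly R[i]}) :=
  [set conj_tree s T | s in [set: absGal R]].

Definition field_of_moduli (R : realType) (T : set {poly R[i]}) :
    set (Qbar R) :=
  [set x | forall s : absGal R, conj_tree s T = T -> s x = x].

(* The fibre over infinity of a plane tree is a single point, hence rational
   over any field of definition, and the model is a polynomial over K. *)
Definition field_of_definition (R : realType) (T : set {poly R[i]})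
    (K : set R[i]) : Prop :=
  is_subfield K /\ exists p : {poly R[i]}, (forall i, K p`_i) /\ T p.

Definition coefE1 (A : comNzRingType) (a : A) : A :=
  3125 * a ^+ 6 - 7500 * a ^+ 5 + 4800 * a ^+ 4 - 112 * a ^+ 3
  - 96 * a ^+ 2 + 1536 * a - 1024.

(* Numerals of ring_scope are unary, so those with five digits or more are split
   into groups of three digits: the constant below is 93312. *)
Definition lhsE1 (A : comNzRingType) (a c : A) : A :=
  coefE1 a * c + (93 * 10 ^+ 3 + 312).

Definition lhsE2 (A : comNzRingType) (a c : A) : A :=
  a ^+ 4 * (a - 1) ^+ 3 * c ^+ 2 - 432.

Definition cubic (A : comNzRingType) (a : A) : A :=
  25 * a ^+ 3 - 12 * a ^+ 2 - 24 * a - 16.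

Definition tree_poly (A : comNzRingType) (a c : A) : {poly A} :=
  c *: ('X ^+ 3 * ('X - 1) ^+ 2 * ('X - a%:P)).

(* Main.v *)
(* The finite critical points of p = c z^3 (z - 1)^2 (z - a) are 0, 1 and the
   roots u, v of 6 z^2 - (4 + 5 a) z + 3 a.  The equation E1 says that
   p(u) + p(v) = 2 and E2 that p(u) p(v) = 1, so together they say that
   p(u) = p(v) = 1.  If u = v the point over 1 has ramification index 3, which
   rules out the quadratic factor 25 a^2 - 32 a + 16 of the resultant;
   otherwise the multiplicities of the roots of p - 1, one more than those of
   p', are 2, 2, 1, 1.  An affine substitution brings every tree with the
   passport to this form, and the root multiplicities 3, 2, 1 leave no freedom,
   so the trees are in bijection with the roots of the cubic, compatibly with
   the Galois action.

   The Galois action is transitive, and the field fixed by the stabilizer of a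
   root x is Q(x), by extension of isomorphisms between subfields of Qbar.  The
   extension goes through Zorn's lemma on graphs of partial morphisms: subrings
   G of Qbar x Qbar containing the diagonal rationals and such that (0, y) in G
   forces y = 0.  Inverses come for free, since the inverse of an algebraic
   number is a rational polynomial in it.

   The cubic has a single real root, so Q(real root) contains no other root;
   transported along conjugations, no Q(a_i) contains another root, whence the
   three fields are distinct and not Galois. *)
Require Import Defs.
From HB Require Import structures.
From mathcomp Require Import all_boot all_order all_algebra all_fingroup
  all_field.
From mathcomp Require Import complex.
From mathcomp Require Import all_classical all_reals all_analysis.
From mathcomp Require Import ring lra zify.

Set Implicit Arguments.
Unset Strict Implicit.
Unset Printing Implicit Defensive.

Import Order.TTheory GRing.Theory Num.Theory.

Local Open Scope classical_set_scope.
Local Open Scope ring_scope.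
Local Open Scope complex_scope.

(** * Critical values of the tree polynomials *)

Lemma vieta2 (K : fieldType) (k b e u v : K) :
  k *: 'X ^+ 2 - b *: 'X + e%:P = k *: (('X - u%:P) * ('X - v%:P)) ->
  b = k * (u + v) /\ e = k * (u * v).
Proof.
move=> E.
(* The leading coefficients agree, so the values at 0 and 1 determine the two others. *)
have c0 := congr1 (fun p : {poly K} => p.[0]) E.
have c1 := congr1 (fun p : {poly K} => p.[1]) E.
rewrite /= !hornerE /= in c0 c1.
have e_uv : e = k * (u * v) by ring: c0.
split=> //; have -> : b = k + e - (k * 1 * 1 - b + e) by ring.
by rewrite c1 e_uv; ring.
Qed.

Lemma tree_poly_deriv (A : comNzRingType) (a c : A) :
  deriv (tree_poly a c) =
  c *: ('X ^+ 2 * ('X - 1) * (6 *: 'X ^+ 2 - (4 + 5 * a) *: 'X + (3 * a)%:P)).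
Proof.
rewrite /tree_poly derivZ; congr (_ *: _).
rewrite !(derivM, derivX, derivXsubC, deriv_exp, derivB, derivC, derivXn) /=.
rewrite -!mul_polyC !rmorphD !rmorphM /=.
ring.
Qed.
Lemma tree_polyE (A : comNzRingType) (a c z : A) :
  (tree_poly a c).[z] = c * (z ^+ 3 * (z - 1) ^+ 2 * (z - a)).
Proof. by rewrite /tree_poly !hornerE. Qed.

(** The product is [c ^+ 2] times [(u v)^3 ((u - 1) (v - 1))^2 (u - a) (v - a)]. Each symmetric
    factor is a sixth of the quadratic evaluated at 0, 1 or [a], namely [a / 2], [(1 - a) / 3] and
    [a (a - 1) / 6], and 432 = 8 * 9 * 6. *)
Lemma critical_value_prod (K : numFieldType) (a c u v : K) :
  4 + 5 * a = 6 * (u + v) -> 3 * a = 6 * (u * v) ->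
  lhsE2 a c = 432 * ((tree_poly a c).[u] * (tree_poly a c).[v] - 1).
Proof.
move=> s p; rewrite !tree_polyE /lhsE2.
have uv : u * v = a / 2 by have -> : a = 3 * a / 3 by [field]; rewrite p; field.
have uv1 : (u - 1) * (v - 1) = (1 - a) / 3.
  have -> : (u - 1) * (v - 1) = u * v - 6 * (u + v) / 6 + 1 by field.
  by rewrite -s uv; field.
have uva : (u - a) * (v - a) = a * (a - 1) / 6.
  have -> : (u - a) * (v - a) = u * v - a * (6 * (u + v) / 6) + a ^+ 2 by field.
  by rewrite -s uv; field.
have -> : c * (u ^+ 3 * (u - 1) ^+ 2 * (u - a)) *
    (c * (v ^+ 3 * (v - 1) ^+ 2 * (v - a))) =
  c ^+ 2 * ((u * v) ^+ 3 * ((u - 1) * (v - 1)) ^+ 2 * ((u - a) * (v - a))).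
  by ring.
by rewrite uv uv1 uva; field.
Qed.

(** The sum is symmetric in [u] and [v], hence [c] times a polynomial in [a]. The constant 46656 = 6
    ^ 6, half of 93312, clears its denominators. *)
Lemma critical_value_sum (K : numFieldType) (a c u v : K) :
  4 + 5 * a = 6 * (u + v) -> 3 * a = 6 * (u * v) ->
  lhsE1 a c = (46 * 10 ^+ 3 + 656) *
     (2 - ((tree_poly a c).[u] + (tree_poly a c).[v])).
Proof.
move=> s p; rewrite !tree_polyE /lhsE1 /coefE1.
(* With d = (a + 2) / 6 the quadratic is 6 (z^2 - (5 d - 1) z + (3 d - 1)),
   which has no denominators left. *)
pose d := (a + 2) / 6; have da : a = 6 * d - 2 by rewrite /d; field.
have uvD : u + v = 5 * d - 1.
  by have -> : u + v = 6 * (u + v) / 6 by [field]; rewrite -s da; field.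
have uvM : u * v = 3 * d - 1.
  by have -> : u * v = 6 * (u * v) / 6 by [field]; rewrite -p da; field.
have hv : v = 5 * d - 1 - u by rewrite -uvD; ring.
have hu : u ^+ 2 = (5 * d - 1) * u - (3 * d - 1) by rewrite -uvM -uvD; ring.
rewrite hv da; ring: hu.
Qed.

Lemma critical_values1 (K : numFieldType) (a c u v : K) :
  6 *: 'X ^+ 2 - (4 + 5 * a) *: 'X + (3 * a)%:P
    = 6 *: (('X - u%:P) * ('X - v%:P)) ->
  lhsE1 a c = 0 /\ lhsE2 a c = 0 <->
  (tree_poly a c).[u] = 1 /\ (tree_poly a c).[v] = 1.
Proof.
move=> /vieta2[s p].
rewrite (critical_value_sum _ s p) (critical_value_prod _ s p).
set x := _.[u]; set y := _.[v]; split=> [[/eqP E1 /eqP E2]|[-> ->]]; last first.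
  by split; ring.
have c_neq0 : 46 * 10 ^+ 3 + 656 != 0 :> K.
  by rewrite -natrX -natrM -natrD pnatr_eq0 addn_eq0 andbF.
have {E1} y_x : y = 2 - x.
  move: E1; rewrite mulf_eq0 (negPf c_neq0) /= => /eqP E.
  by rewrite -[LHS]addr0 -E; ring.
move: E2; rewrite mulf_eq0 pnatr_eq0 /= y_x => /eqP E.
(* Sum 2 and product 1 make [x] a double root of the square of ['X - 1]. *)
have /eqP : (x - 1) ^+ 2 = 0 by rewrite -oppr0 -E; ring.
by rewrite expf_eq0 subr_eq0 => /eqP ->; split=> //; ring.
Qed.

(** * Elimination of [c] by a Sylvester determinant *)

Lemma det_mx3 (A : comNzRingType) (F : nat -> nat -> A) :
  \det (\matrix_(i < 3, j < 3) F i j) =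
    F 0 0 * (F 1 1 * F 2 2 - F 1 2 * F 2 1)
    - F 0 1 * (F 1 0 * F 2 2 - F 1 2 * F 2 0)
    + F 0 2 * (F 1 0 * F 2 1 - F 1 1 * F 2 0) :> A.
Proof.
have det_mx2 (M : 'M[A]_2) : \det M =
    M ord0 ord0 * M (lift ord0 ord0) (lift ord0 ord0)
    - M ord0 (lift ord0 ord0) * M (lift ord0 ord0) ord0.
  rewrite (expand_det_row _ ord0) /cofactor !big_ord_recl big_ord0 /=.
  have l0 : lift (lift ord0 ord0) 0%R = ord0 :> 'I_2 by exact/val_inj.
  rewrite !det_mx11 !mxE l0 /= /bump /=.
by ring.
rewrite (expand_det_row _ ord0) /cofactor !big_ord_recl big_ord0 /=.
rewrite !det_mx2 !mxE /= /bump /=. ring.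
Qed.

(** The value is [a1 ^+ 2] times the quadratic evaluated at [- a0 / a1]. Nonzero leading
    coefficients fix the sizes, hence the shape of the Sylvester matrix. *)
Lemma resultant_deg12 (A : idomainType) (a1 a0 b2 b1 b0 : A) :
  a1 != 0 -> b2 != 0 ->
  resultant (a1 *: 'X + a0%:P) (b2 *: 'X^2 + b1 *: 'X + b0%:P) =
  a1 ^+ 2 * b0 - a1 * a0 * b1 + a0 ^+ 2 * b2.
Proof.
move=> a1N0 b2N0; set p := _ + _; set q := _ + _%:P.
have Dp : p = Poly [:: a0; a1].
  by rewrite /= !cons_poly_def mul0r add0r mul_polyC.
have Dq : q = Poly [:: b0; b1; b2].
  by rewrite /= !cons_poly_def mul0r add0r /q -!mul_polyC; ring.
have sp : size p = 2%N by rewrite Dp (@PolyK _ 0).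
have sq : size q = 3%N by rewrite Dq (@PolyK _ 0).
have cp i : p`_i = [:: a0; a1]`_i by rewrite Dp coef_Poly.
have cq i : q`_i = [:: b0; b1; b2]`_i by rewrite Dq coef_Poly.
rewrite /resultant /Sylvester_mx; clearbody p q; rewrite sp sq /=.
(* Two shifted rows of [p], then one row of [q]. The boolean multiplicity kills the entries left of
   the shift, where truncated subtraction would return the constant coefficient. *)
pose F i j := if (i < 2)%N then p`_(j - i) *+ (i <= j) else q`_(j - (i - 2)) *+
  (i - 2 <= j).
transitivity (\det (\matrix_(i < 3, j < 3) F i j)).
  congr (\det _); apply/matrixP => i j; rewrite !mxE /F.
  case: splitP => k ->; rewrite !mxE /= rVpoly_delta coefXnM ltnNge if_neg
    -mulrb.
    by rewrite ltn_ord.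
  by rewrite addKn.
rewrite det_mx3 /F /= !cp !cq /=; ring.
Qed.

Lemma rmorph_coefE1 (A B : comNzRingType) (f : {rmorphism A -> B}) (a : A) :
  f (coefE1 a) = coefE1 (f a).
Proof.
by rewrite /coefE1 !(rmorph_nat, rmorphXn, rmorphM, rmorphN, rmorphB, rmorphD).
Qed.

Lemma rmorph_cubic (A B : comNzRingType) (f : {rmorphism A -> B}) (a : A) :
  f (cubic a) = cubic (f a).
Proof.
by rewrite /cubic !(rmorph_nat, rmorphXn, rmorphM, rmorphN, rmorphB, rmorphD).
Qed.

Lemma resultant_E1_E2 :
  resultant (lhsE1 ('X%:P : {poly {poly rat}}) 'X)
            (lhsE2 ('X%:P : {poly {poly rat}}) 'X)
  = - 432 * (25 * 'X ^+ 2 - 32 * 'X + 16) ^+ 3 * cubic 'X ^+ 2.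
Proof.
have -> : lhsE1 ('X%:P : {poly {poly rat}}) 'X =
    coefE1 'X *: 'X + (93 * 10 ^+ 3 + 312)%:P.
  rewrite -mul_polyC /lhsE1 -rmorph_coefE1; congr (_ * _ + _).
  by rewrite !(rmorph_nat, rmorphXn, rmorphM, rmorphD).
have -> : lhsE2 ('X%:P : {poly {poly rat}}) 'X =
    ('X ^+ 4 * ('X - 1) ^+ 3) *: 'X ^+2 + 0 *: 'X + (- 432)%:P.
  rewrite scale0r addr0 -mul_polyC /lhsE2; congr (_ * _ + _).
    by rewrite !(rmorph1, rmorphXn, rmorphM, rmorphB).
  by rewrite !(rmorph_nat, rmorphN).
rewrite resultant_deg12.
- by rewrite /coefE1 /cubic; ring.
(* The leading coefficient in [c] is a nonzero polynomial in [a], its value at 0 being -1024. *)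
- apply/eqP => /(congr1 (horner_eval 0)).
  rewrite rmorph_coefE1 [X in coefE1 X](hornerX 0) /horner_eval horner0.
  have -> : coefE1 (0 : rat) = - 1024 by rewrite /coefE1; ring.
  by move=> /eqP; rewrite oppr_eq0 pnatr_eq0.
- by rewrite mulf_neq0 ?expf_neq0 ?polyX_eq0 // -polyC1 polyXsubC_eq0.
Qed.

(** * The cubic over the rationals *)

Lemma cubic_polyE (F : fieldType) : cubic 'X = Poly [:: -16; -24; -12;
  25] :> {poly F}.
Proof.
rewrite /= !cons_poly_def mul0r add0r /cubic.
rewrite !(polyCN, polyC_natr).
by ring.
Qed.

Lemma size_cubic (F : numFieldType) : size (cubic 'X : {poly F}) = 4%N.
Proof. by rewrite cubic_polyE (@PolyK _ 0) //= pnatr_eq0. Qed.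

Lemma horner_cubic (A : comNzRingType) (x : A) : (cubic 'X).[x] = cubic x.
Proof.
have := rmorph_cubic (horner_eval x) 'X.
by rewrite [X in _ = cubic X](hornerX x).
Qed.

(* Modulo 7 the cubic has no root, so a rational root would have numerator and
   denominator both divisible by 7. *)
Lemma cubic_irreducible_rat : irreducible_poly (cubic 'X : {poly rat}).
Proof.
apply: cubic_irreducible; first by rewrite size_cubic.
move=> x; rewrite rootE horner_cubic; apply/negP => /eqP E.
pose m := numq x; pose n := denq x.
have n0 : n%:~R != 0 :> rat by rewrite intr_eq0 denq_neq0.
have {}E : 25 * m ^+ 3 - 12 * m ^+ 2 * n - 24 * m * n ^+ 2 - 16 * n ^+ 3 = 0.
  apply: (@intr_inj rat).
  rewrite !(rmorph_nat, rmorphXn, rmorphM, rmorphN, rmorphB, rmorphD) /=.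
  have -> : m%:~R = x * n%:~R :> rat.
    by rewrite -[in RHS](divq_num_den x) divfK.
  transitivity (cubic x * n%:~R ^+ 3); last by rewrite E mul0r.
  by rewrite /cubic; ring.
have p7 : 7%N \in [pchar 'F_7] by exact: pchar_Fp.
(* Modulo 7 the coefficients 25, -12, -24, -16 become 4, 2, 4, 5. All 49 pairs are tested by
   computation. *)
have cubic_F7 (a b : 'F_7) :
    4 * a ^+ 3 + 2 * a ^+ 2 * b + 4 * a * b ^+ 2 + 5 * b ^+ 3 = 0 ->
  (a == 0) && (b == 0).
  move=> /eqP; apply/implyP; move: a b.
  by do 2 case=> -[|[|[|[|[|[|[|//]]]]]]] ?; vm_compute.
have : (m%:~R == 0 :> 'F_7) && (n%:~R == 0 :> 'F_7).
  apply: cubic_F7; have := congr1 (intr : int -> 'F_7) E.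
  rewrite !(rmorph_nat, rmorphXn, rmorphM, rmorphN, rmorphB, rmorphD, rmorph0)
    /=.
  move: (m%:~R) (n%:~R) => a b <-.
  have e7 : 7 = 0 :> 'F_7 by apply/val_inj.
  rewrite -[LHS]addr0 -[X in _ + X](mul0r (3 * a ^+ 3 - 2 * a ^+ 2 * b
    - 4 * a * b ^+ 2 - 3 * b ^+ 3)) -e7.
  by ring.
rewrite -!(dvdz_pcharf p7) !dvdzE => /andP[dm dn].
have := coprime_num_den x.
rewrite -/m -/n => /eqP g1.
by have := dvdn_gcd 7 `|m| `|n|; rewrite g1 dm dn.
Qed.

Lemma const_E1_neq0 (K : numFieldType) : 93 * 10 ^+ 3 + 312 != 0 :> K.
Proof. by rewrite -natrX -natrM -natrD pnatr_eq0 addn_eq0 andbF. Qed.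

Lemma cubic_root_neq01 (K : numFieldType) (a : K) :
  cubic a = 0 -> a != 0 /\ a != 1.
Proof.
move=> a_root; split; apply: contra_eqN a_root => /eqP ->; rewrite /cubic.
  by rewrite (_ : _ - _ = - 16) ?oppr_eq0 ?pnatr_eq0 //; ring.
by rewrite (_ : _ - _ = - 27) ?oppr_eq0 ?pnatr_eq0 //; ring.
Qed.

(** * Ramification of polynomials and affine equivalence *)

(** Roots come with their exponents, so that a ramification partition is the list [unzip2 s].
    Distinct roots and positive exponents are required separately, where the partition is read
    off. *)
Definition root_prod (K : nzRingType) (s : seq (K * nat)) : {poly K} :=
  \prod_(t <- s) ('X - t.1%:P) ^+ t.2.

Lemma monic_root_prod (K : nzRingType) (s : seq (K * nat)) :
  root_prod s \is monic.
Proof. by apply: monic_prod => t _; apply: monic_exp; exact: monicXsubC. Qed.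

Lemma mupZ (K : fieldType) (c z : K) (p : {poly K}) :
  c != 0 -> mup z (c *: p) = mup z p.
Proof. by move=> c0; rewrite -mul_polyC mupMr // rootC. Qed.

Lemma mup_root_prod (K : fieldType) (z : K) (s : seq (K * nat)) :
  mup z (root_prod s) = (\sum_(t <- s | t.1 == z) t.2)%N.
Proof.
rewrite /root_prod; elim: s => [|t s IHs].
  by rewrite !big_nil mupNroot // root1.
rewrite !big_cons mupM ?monic_neq0 ?monic_exp ?monicXsubC //; last first.
  exact: (monic_root_prod s).
by rewrite mup_XsubCX IHs; case: ifP.
Qed.

Lemma mup_root_prod_uniq (K : fieldType) (s : seq (K * nat)) :
  uniq (unzip1 s) ->
  [seq mup z (root_prod s) | z <- unzip1 s] = unzip2 s.
Proof.
rewrite -map_comp => us; apply/eq_in_map => t ts /=; rewrite mup_root_prod.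
elim: s us ts => //= h s IHs /andP[hs us]; rewrite inE big_cons.
case/orP => [/eqP ->|ts].
  rewrite eqxx big1_seq ?addn0 // => t' /andP[/eqP t'h t's].
  by case/negP: hs; rewrite -t'h; exact: map_f.
by rewrite (IHs us ts) ifN //; apply: contraNneq hs => ->; exact: map_f.
Qed.

Lemma root_root_prod (K : fieldType) (s : seq (K * nat)) z :
  all (fun t => 0 < t.2)%N s -> root (root_prod s) z = (z \in unzip1 s).
Proof.
move=> /allP s0; rewrite -dvdp_XsubCl XsubC_dvd ?monic_neq0 ?monic_root_prod //.
rewrite mup_root_prod lt0n sum_nat_seq_neq0.
apply/hasP/mapP => [[t ts /andP[/eqP <- _]]|[t ts ->]]; first by exists t.
by exists t => //; rewrite eqxx -lt0n s0.
Qed.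

(** Characteristic 0 enters through the cofactor of [deriv p]: its value at [z] is [k.+1%:R *
    g.[z]], which is nonzero. *)
Lemma mup_deriv (K : numFieldType) (p : {poly K}) z : root p z ->
  p != 0 -> mup z p = (mup z (deriv p)).+1.
Proof.
move=> pz p0.
have [k [g [gz Dp]]] : exists k g, ~~ root g z /\ p = ('X - z%:P) ^+ k.+1 * g.
  have [k [g]] := multiplicity_XsubC p z; rewrite p0 /= => gz.
  case: k => [|k] Dp; first by move: pz; rewrite Dp expr0 mulr1 (negPf gz).
  by exists k, g; rewrite mulrC.
have h_z : ~~ root (k.+1%:R *: g + ('X - z%:P) * deriv g) z.
  rewrite rootE !hornerE subrr mul0r addr0 mulf_neq0 ?pnatr_eq0 //.
have -> : deriv p = ('X - z%:P) ^+ k * (k.+1%:R *: g + ('X - z%:P) * deriv g).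
  rewrite Dp derivM deriv_exp derivXsubC /= mul1r -mul_polyC polyC_natr exprS.
  by ring.
by rewrite Dp !mupMl // !mup_XsubCX eqxx.
Qed.

Section Ramification.
Variable R : realType.
Implicit Types (p q : {poly R[i]}) (y c : R[i]) (s : seq (R[i] * nat)).

Lemma geq_total : total geq. Proof. by move=> m n; exact: leq_total. Qed.
Lemma geq_trans : transitive geq.
Proof. by move=> n m k /= nm kn; exact: leq_trans kn nm. Qed.
Lemma geq_anti : antisymmetric geq.
Proof. by move=> m n; rewrite /= andbC; exact: anti_leq. Qed.

(** The definition of [ramification] uses a chosen list of roots. Sorting erases that choice, so any
    factorization with distinct roots computes the partition. *)
Lemma ramificationE p y c s : c != 0 -> p - y%:P = c *: root_prod s ->
  uniq (unzip1 s) -> all (fun t => 0 < t.2)%N s ->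
  ramification p y = sort geq (unzip2 s).
Proof.
move=> c0 Dq us s0; rewrite /ramification Dq.
case: closed_field_poly_normal => r /= Dr.
apply/(perm_sortP geq_total geq_trans geq_anti).
rewrite -(mup_root_prod_uniq us) (eq_map (fun z => mupZ z (root_prod s) c0)).
apply/perm_map/uniq_perm; rewrite ?undup_uniq // => z.
rewrite mem_undup -(root_root_prod z s0) -(rootZ z (root_prod s) c0) Dr rootZ
  ?root_prod_XsubC //.
by rewrite lead_coef_eq0 scaler_eq0 negb_or c0 monic_neq0 ?monic_root_prod.
Qed.

(** Listing the roots by decreasing multiplicity makes the exponents equal to the partition itself,
    not just a permutation of it, so a prescribed partition can be matched with named roots. *)
Lemma ramification_factor p y : p - y%:P != 0 ->
  exists s, [/\ uniq (unzip1 s), all (fun t => 0 < t.2)%N s,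
    unzip2 s = ramification p y &
    p - y%:P = lead_coef (p - y%:P) *: root_prod s].
Proof.
rewrite /ramification; set q : {poly R[i]} := p - _ => q0.
case: closed_field_poly_normal => r /= Dr.
have mupE z : mup z q = count_mem z r.
  by rewrite Dr mupZ ?lead_coef_eq0 // mu_prod_XsubC.
pose zs := sort (relpre (fun z : R[i] => mup z q) geq) (undup r).
have pzs : perm_eq zs (undup r) by rewrite perm_sort.
exists [seq (z, mup z q) | z <- zs]; split.
- by rewrite /unzip1 -map_comp map_id (perm_uniq pzs) undup_uniq.
- apply/allP => _ /mapP[z zr ->] /=; rewrite mupE -has_count has_pred1.
  by rewrite -mem_undup -(perm_mem pzs).
- by rewrite /unzip2 -map_comp sort_map.
- rewrite /root_prod big_map (perm_big _ pzs) /= [LHS]Dr; congr (_ *: _).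
  rewrite -(big_undup_iterop_count *%R); apply: eq_bigr => z _.
  by rewrite mupE.
Qed.

Lemma belyi_iso_refl p : belyi_iso p p.
Proof.
by exists 1, 0; rewrite oner_eq0 scale1r addr0 comp_polyXr.
Qed.

Lemma belyi_iso_sym p q : belyi_iso p q -> belyi_iso q p.
Proof.
move=> [u [v [u0 ->]]]; exists u^-1, (- v / u); split;
  first by rewrite invr_eq0.
rewrite -comp_polyA comp_polyD comp_polyZ comp_polyX comp_polyC scalerDr
  scalerA.
rewrite mulfV // scale1r -mul_polyC -polyCM -addrA -polyCD.
by rewrite mulrCA mulfV // mulr1 addNr addr0 comp_polyXr.
Qed.

Lemma belyi_iso_trans p q t : belyi_iso p q -> belyi_iso q t -> belyi_iso p t.
Proof.
move=> [u [v [u0 ->]]] [u' [v' [u'0 ->]]].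
exists (u * u'), (u * v' + v); split; first by rewrite mulf_neq0.
rewrite -comp_polyA comp_polyD comp_polyZ comp_polyX comp_polyC;
  congr (_ \Po _).
by rewrite scalerDr scalerA -addrA polyCD polyCM mul_polyC.
Qed.

Lemma dessinP p q : dessin p = dessin q <-> belyi_iso p q.
Proof.
split=> [E|pq]; first by have : dessin q q by [exact: belyi_iso_refl];
  rewrite -E.
apply/seteqP; split=> t /= H; last exact: belyi_iso_trans H.
by apply: belyi_iso_trans H; exact: belyi_iso_sym.
Qed.

Lemma size_affine_comp p (u v : R[i]) : u != 0 ->
  size (p \Po (u *: 'X + v%:P)) = size p.
Proof.
move=> u0; rewrite size_comp_poly2 //.
by rewrite -mul_polyC size_MXaddC polyC_eq0 (negPf u0) /= size_polyC u0.
Qed.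

Lemma affine_root_prod s (u v : R[i]) : u != 0 ->
  root_prod s \Po (u *: 'X + v%:P) =
  u ^+ (\sum_(t <- s) t.2) *: root_prod [seq ((t.1 - v) / u, t.2) | t <- s].
Proof.
move=> u0; rewrite /root_prod big_map rmorph_prod /=.
elim: s => [|t s IHs]; first by rewrite !big_nil scale1r.
have E : ('X - t.1%:P) \Po (u *: 'X + v%:P) = u *: ('X - ((t.1 - v) / u)%:P).
  rewrite comp_polyB comp_polyX comp_polyC scalerBr -!mul_polyC -addrA -polyCM.
  by rewrite mulrCA mulfV // mulr1 -polyCB -polyCN opprB.
rewrite !big_cons IHs [('X - _) ^+ _ \Po _]rmorphXn /= E exprZn.
by rewrite -scalerAl -scalerAr scalerA -exprD.
Qed.

Lemma ramification_iso p q y : (1 < size p)%N -> belyi_iso p q ->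
  ramification q y = ramification p y.
Proof.
move=> p1 [u [v [u0 ->]]].
have q0 : p - y%:P != 0.
  apply: contraTneq p1 => /eqP; rewrite subr_eq0 => /eqP ->.
  by rewrite -leqNgt size_polyC leq_b1.
have [s [us s0 sE Dp]] := ramification_factor q0.
rewrite -sE.
pose s' := [seq ((t.1 - v) / u, t.2) | t <- s].
have -> : unzip2 s = unzip2 s' by rewrite /unzip2 -map_comp.
rewrite (@ramificationE _ y (lead_coef (p - y%:P) * u ^+ (\sum_(t <- s) t.2))
  s').
- by rewrite /unzip2 -map_comp [X in sort _ X]sE (sorted_sort geq_trans)
    ?(sort_sorted geq_total).
- by rewrite mulf_neq0 ?lead_coef_eq0 ?expf_neq0.
- by rewrite -scalerA -affine_root_prod // -comp_polyZ -Dp comp_polyB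
    comp_polyC.
- rewrite /unzip1 -map_comp (map_comp (fun z => (z - v) / u) fst) map_inj_uniq
    //.
  by move=> x x' /(mulIf (invr_neq0 u0)) /addIr.
- by rewrite all_map.
Qed.

Lemma belyi_poly_iso p q : belyi_iso p q -> belyi_poly p -> belyi_poly q.
Proof.
move=> [u [v [u0 ->]]] [p1 bp]; split; first by rewrite size_affine_comp.
move=> z; rewrite deriv_comp derivD derivZ derivX derivC addr0 alg_polyC.
rewrite rootM rootC (negPf u0) orbF => pz.
by rewrite horner_comp; apply: bp; move: pz; rewrite !rootE horner_comp.
Qed.

Lemma passport_iso p q : belyi_iso p q -> (1 < size p)%N ->
  passport q = passport p.
Proof.
move=> pq p1; rewrite /passport !(ramification_iso _ p1 pq).
by case: pq => u [v [u0 ->]]; rewrite size_affine_comp.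
Qed.
End Ramification.

(** * Trees with the given passport *)

Lemma root_prod_nil (K : nzRingType) : root_prod [::] = 1 :> {poly K}.
Proof. exact: big_nil. Qed.

Lemma root_prod_cons (K : nzRingType) (x : K) (m : nat) (s : seq (K * nat)) :
  root_prod ((x, m) :: s) = ('X - x%:P) ^+ m * root_prod s.
Proof. exact: big_cons. Qed.

Lemma size_root_prod (K : idomainType) (s : seq (K * nat)) :
  size (root_prod s) = (sumn (unzip2 s)).+1.
Proof.
elim: s => [|t s IHs]; first by rewrite /root_prod big_nil size_poly1.
rewrite /root_prod big_cons -/(root_prod s) size_Mmonic ?monic_root_prod //.
  by rewrite size_exp_XsubC IHs /= addnS.
by rewrite monic_neq0 // monic_exp ?monicXsubC.
Qed.

Lemma tree_poly_root_prod (A : comNzRingType) (a c : A) :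
  tree_poly a c = c *: root_prod [:: (0, 3%N); (1, 2%N); (a, 1%N)].
Proof. by rewrite !root_prod_cons root_prod_nil polyC0 subr0 mulr1 mulrA. Qed.

Lemma tree_poly_deriv_root_prod (A : comNzRingType) (a c u v : A) :
  6 *: 'X ^+ 2 - (4 + 5 * a) *: 'X + (3 * a)%:P
    = 6 *: (('X - u%:P) * ('X - v%:P)) ->
  deriv (tree_poly a c) =
  (c * 6) *: root_prod [:: (0, 2%N); (1, 1%N); (u, 1%N); (v, 1%N)].
Proof.
move=> E; rewrite tree_poly_deriv E -scalerA -scalerAr; do 2!congr (_ *: _).
by rewrite !root_prod_cons root_prod_nil polyC0 subr0 mulr1 !mulrA.
Qed.

Lemma tree_poly_deriv_root (A : comNzRingType) (a c u v z : A) :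
  6 *: 'X ^+ 2 - (4 + 5 * a) *: 'X + (3 * a)%:P
    = 6 *: (('X - u%:P) * ('X - v%:P)) ->
  (z - u) * (z - v) = 0 -> root (deriv (tree_poly a c)) z.
Proof.
move=> E z0; rewrite tree_poly_deriv E rootE hornerZ -scalerAr hornerZ.
by rewrite hornerM [(('X - u%:P) * _).[z]]hornerM !hornerXsubC z0 !mulr0.
Qed.

Section Trees.
Variable R : realType.
Implicit Types (a c u v z : R[i]).

(** This form serves for the fibre over 1, where no factorization is at hand: the partition is
    recovered from local multiplicities and their total. *)
Lemma ramification_mup (p : {poly R[i]}) y (q := p - y%:P) : q != 0 ->
  exists zs : seq R[i],
    [/\ uniq zs, forall z, (z \in zs) = root q z,
        ramification p y = [seq mup z q | z <- zs],
        sumn (ramification p y) = (size q).-1 & sorted geq (ramification p y)].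
Proof.
move=> q0; have [s [us s0 sE Dq]] := ramification_factor q0.
have lc0 : lead_coef q != 0 by rewrite lead_coef_eq0.
exists (unzip1 s); split=> //.
- by move=> z; rewrite /q Dq rootZ // root_root_prod.
- rewrite -sE -mup_root_prod_uniq //; apply: eq_map => z.
  by rewrite /q Dq mupZ.
- by rewrite /q Dq size_scale // size_root_prod sE.
- by rewrite /ramification sort_sorted //; exact: geq_total.
Qed.

Lemma size_tree_poly a c : c != 0 -> size (tree_poly a c) = 7%N.
Proof. by move=> c0; rewrite tree_poly_root_prod size_scale // size_root_prod.
  Qed.

Lemma tree_poly_neq0 a c z : c != 0 -> tree_poly a c - z%:P != 0.
Proof.
move=> c0; rewrite -size_poly_gt0 size_polyDl size_tree_poly //.
by rewrite size_polyN size_polyC; case: (_ != _).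
Qed.

(** The discriminant of the quadratic is the other factor of the resultant, so that factor vanishes
    exactly when the two critical points collide. *)
Lemma quadratic_factor a : exists u v : R[i],
  6 *: 'X ^+ 2 - (4 + 5 * a) *: 'X + (3 * a)%:P
    = 6 *: (('X - u%:P) * ('X - v%:P))
  /\ 36 * (u - v) ^+ 2 = 25 * a ^+ 2 - 32 * a + 16.
Proof.
pose w := sqrtC (25 * a ^+ 2 - 32 * a + 16).
have ww : w ^+ 2 = 25 * a ^+ 2 - 32 * a + 16 by rewrite sqrtCK.
exists ((4 + 5 * a + w) / 12), ((4 + 5 * a - w) / 12); split; last first.
  by rewrite -ww; field.
have -> : 3 * a = 6 * ((4 + 5 * a + w) / 12 * ((4 + 5 * a - w) / 12)).
  by field: ww.
have {1}-> : 4 + 5 * a = 6 * ((4 + 5 * a + w) / 12 + (4 + 5 * a - w) / 12).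
  by field.
move: (_ / 12) (_ / 12) => u v.
rewrite -!mul_polyC !(polyC_natr, polyCM, polyCD).
by ring.
Qed.

Lemma lhsE1_c_neq0 a c : lhsE1 a c = 0 -> c != 0.
Proof.
by apply: contra_eqN => /eqP ->; rewrite /lhsE1 mulr0 add0r const_E1_neq0.
Qed.

(** One Euclidean division: the cubic leaves the remainder [- (72 / 5) * (a + 2)] modulo the
    quadratic, whose value at -2 is 180. *)
Lemma cubic_disc_neq0 a : cubic a = 0 -> 25 * a ^+ 2 - 32 * a + 16 != 0.
Proof.
move=> E; apply/negP => /eqP D.
have a2 : a = - 2.
  have : cubic a - (a + 4 / 5) * (25 * a ^+ 2 - 32 * a + 16) = 0.
    by rewrite E D mulr0 subr0.
  rewrite (_ : _ - _ = - (72 / 5) * (a + 2)); last by rewrite /cubic; field.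
  move=> /eqP; rewrite mulf_eq0 oppr_eq0 mulf_eq0 invr_eq0 !pnatr_eq0 /=.
  by rewrite addr_eq0 => /eqP.
move: D; rewrite a2 (_ : _ + 16 = 180); last by ring.
by move=> /eqP; rewrite pnatr_eq0.
Qed.

Lemma tree_passport_sufficient a c :
  lhsE1 a c = 0 -> lhsE2 a c = 0 -> cubic a = 0 ->
  belyi_poly (tree_poly a c) /\
  passport (tree_poly a c) = ([:: 3; 2; 1], [:: 2; 2; 1; 1], [:: 6])%N.
Proof.
move=> E1 E2 a_root; have c0 := lhsE1_c_neq0 E1.
have [a0 a1] := cubic_root_neq01 a_root; have D0 := cubic_disc_neq0 a_root.
have [u [v [uvE uvD]]] := quadratic_factor a.
have [pu pv] : (tree_poly a c).[u] = 1 /\ (tree_poly a c).[v] = 1.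
  by apply/(critical_values1 c uvE).
have val01 z : (tree_poly a c).[z] = 1 -> z != 0 /\ z != 1.
  move=> pz; split; apply: contra_eqN pz => /eqP ->; rewrite tree_polyE.
    by rewrite expr0n !mul0r mulr0 eq_sym oner_eq0.
  by rewrite subrr expr0n mulr0 mul0r mulr0 eq_sym oner_eq0.
have [u0 u1] := val01 _ pu; have [v0 v1] := val01 _ pv.
have uv : u != v.
  by apply: contraNneq D0 => uv; rewrite -uvD uv subrr expr0n mulr0.
have c6 : c * 6 != 0 by rewrite mulf_neq0 ?pnatr_eq0.
have dE := tree_poly_deriv_root_prod c uvE.
split.
  split=> [|z]; first by rewrite size_tree_poly.
  rewrite dE rootZ // root_root_prod //= !inE.
  case/or4P => /eqP ->; [left|left|by right|by right]; rewrite tree_polyE.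
    by rewrite expr0n !mul0r mulr0.
  by rewrite subrr expr0n mulr0 mul0r mulr0.
rewrite /passport size_tree_poly //; congr (_, _, _).
  rewrite (@ramificationE _ _ 0 c [:: (0, 3%N); (1, 2%N); (a, 1%N)]) //.
    by rewrite subr0 tree_poly_root_prod.
  by rewrite /= !inE eq_sym oner_eq0 (eq_sym 0) (negPf a0) eq_sym (negPf a1).
set p := tree_poly a c; set q := p - 1%:P.
have q0 : q != 0 by exact: tree_poly_neq0.
have dq : deriv q = deriv p by rewrite derivB derivC subr0.
have [zs [uzs zsE ramE sumE sortE]] := ramification_mup q0.
have rootq z : root q z = (p.[z] == 1).
  by rewrite rootE hornerD hornerN hornerC subr_eq0.
(* The critical points 0 and 1 lie over 0, so in the fibre over 1 only [u] and [v] are critical;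
   each is a simple root of the derivative. *)
have mupE z : root q z -> mup z q = (z \in [:: u; v]).+1.
  move=> qz; rewrite mup_deriv // dq dE mupZ // mup_root_prod.
  have [z0 z1] : z != 0 /\ z != 1 by apply: val01; apply/eqP; rewrite -rootq.
  rewrite !big_cons big_nil /= !inE eq_sym (negPf z0) (eq_sym 1) (negPf z1).
  rewrite (eq_sym u) (eq_sym v).
  have [->|zu] := eqVneq z u; first by rewrite (negPf uv).
  by case: (z == v).
have uzs' : u \in zs by rewrite zsE rootq pu.
have vzs : v \in rem u zs by rewrite mem_rem_uniq // !inE eq_sym uv zsE rootq
  pv /=.
pose l := rem v (rem u zs).
have pzs : perm_eq zs [:: u, v & l].
  by rewrite (permPl (perm_to_rem uzs')) perm_cons perm_to_rem.
have lE : [seq mup z q | z <- l] = nseq (size l) 1%N.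
  rewrite -(size_map (fun z : R[i] => mup z q)); apply/all_pred1P;
    rewrite all_map; apply/allP => z zl /=.
  have : uniq [:: u, v & l] by rewrite -(perm_uniq pzs).
  rewrite /= inE negb_or => /and3P[/andP[_ ul] vl _].
  have zzs : z \in zs by rewrite (perm_mem pzs) !inE zl !orbT.
  rewrite mupE -?zsE // !inE.
  have -> : (z == u) = false by apply: contraNF ul => /eqP <-.
  by have -> : (z == v) = false by apply: contraNF vl => /eqP <-.
have pram : perm_eq (ramification p 1) [:: 2, 2 & nseq (size l) 1]%N.
  rewrite ramE (permPl (perm_map _ pzs)) /= lE !mupE ?rootq ?pu ?pv //.
  by rewrite !inE !eqxx orbT.
(* The multiplicities add up to the degree 6, and the double roots [u] and [v] account for 4 of
   it. *)
have sl : size l = 2%N.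
  have := perm_sumn pram; rewrite sumE /q.
  rewrite size_polyDl ?size_tree_poly //; last by rewrite size_polyN
    size_polyC; case: (_ != _).
  by rewrite /= sumn_nseq; move: (size l) => n; clear; lia.
rewrite sl in pram.
rewrite -(sorted_sort geq_trans sortE).
by have /(perm_sortP geq_total geq_trans geq_anti) -> := pram.
Qed.

End Trees.

Section TreeClassification.
Variable R : realType.
Implicit Types (a c u v z : R[i]).

Lemma tree_passport_necessary a c :
  belyi_poly (tree_poly a c) ->
  passport (tree_poly a c) = ([:: 3; 2; 1], [:: 2; 2; 1; 1], [:: 6])%N ->
  [/\ lhsE1 a c = 0, lhsE2 a c = 0 & cubic a = 0].
Proof.
set p := tree_poly a c; case=> p1 bp [ram0 ram1 _].
have c0 : c != 0.
  by apply: contraTneq p1; rewrite /p /tree_poly => ->;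
    rewrite scale0r size_poly0.
(* If [a] were 0 or 1, two black vertices would merge and the partition over 0 would be 4, 2 or 3,
   3. *)
have a0 : a != 0.
  apply: contra_eqN ram0 => /eqP a0; rewrite (@ramificationE _ _ 0 c [:: (0,
    4%N); (1, 2%N)]) //.
    rewrite subr0 /p tree_poly_root_prod a0 !root_prod_cons root_prod_nil.
    by congr (_ *: _); ring.
  by rewrite /= inE eq_sym oner_eq0.
have a1 : a != 1.
  apply: contra_eqN ram0 => /eqP a1; rewrite (@ramificationE _ _ 0 c [:: (0,
    3%N); (1, 3%N)]) //.
    rewrite subr0 /p tree_poly_root_prod a1 !root_prod_cons root_prod_nil.
    by congr (_ *: _); ring.
  by rewrite /= inE eq_sym oner_eq0.
have [u [v [uvE uvD]]] := quadratic_factor a.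
(* The quadratic takes the nonzero values [3 * a], [2 * (1 - a)], [a * (a - 1)] at 0, 1, [a]. Its
   roots are therefore not over 0, and the Belyi condition puts them over 1. *)
have crit z : z \in [:: u; v] -> p.[z] = 1.
  move=> zuv; have c6 : c * 6 != 0 by rewrite mulf_neq0 ?pnatr_eq0.
  have qz : 6 * z ^+ 2 - (4 + 5 * a) * z + 3 * a = 0.
    have [-> ->] := vieta2 uvE.
    by move: zuv; rewrite !inE => /orP[] /eqP ->; ring.
  have /bp[] : root (deriv p) z.
  - rewrite (tree_poly_deriv_root_prod c uvE) rootZ // root_root_prod //= !inE.
    by move: zuv; rewrite !inE => ->; rewrite !orbT.
  - move=> /rootP; rewrite /p tree_poly_root_prod rootZ // root_root_prod //=
      !inE.
    case/or3P => /eqP zE; exfalso; move: qz; rewrite zE => /eqP; apply/negP.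
    + rewrite (_ : _ + _ = 3 * a); last by ring.
      by rewrite mulf_neq0 ?pnatr_eq0.
    + rewrite (_ : _ + _ = 2 * (1 - a)); last by ring.
      by rewrite mulf_neq0 ?pnatr_eq0 // subr_eq0 eq_sym.
    + rewrite (_ : _ + _ = a * (a - 1)); last by ring.
      by rewrite mulf_neq0 // subr_eq0.
  - by [].
have [E1 E2] : lhsE1 a c = 0 /\ lhsE2 a c = 0.
  by apply/(critical_values1 c uvE); split; apply: crit;
    rewrite !inE eqxx ?orbT.
split=> //; apply/eqP/negPn/negP => cub0.
(* The resultant is an explicit combination of the two equations, so it vanishes here. As the cubic
   is assumed nonzero, the quadratic factor must vanish. *)
have D0 : 25 * a ^+ 2 - 32 * a + 16 = 0.
  have : (- 432) * (25 * a ^+ 2 - 32 * a + 16) ^+ 3 * cubic a ^+ 2 = 0.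
    have -> : (- 432) * (25 * a ^+ 2 - 32 * a + 16) ^+ 3 * cubic a ^+ 2 =
        (93 * 10 ^+ 3 + 312 - coefE1 a * c) * (a ^+ 4 * (a - 1) ^+ 3) * lhsE1 a
          c
        + coefE1 a ^+ 2 * lhsE2 a c.
      by rewrite /lhsE1 /lhsE2 /coefE1 /cubic; ring.
    by rewrite E1 E2 !mulr0 addr0.
  move=> /eqP; rewrite mulf_eq0 [_ * _ ^+ 3 == 0]mulf_eq0 oppr_eq0 pnatr_eq0 /=.
  by rewrite !expf_eq0 /= (negPf cub0) orbF => /eqP.
have uv : u = v.
  move: uvD; rewrite D0 => /eqP; rewrite mulf_eq0 pnatr_eq0 /= expf_eq0 /=.
  by rewrite subr_eq0 => /eqP.
have q0 : p - 1%:P != 0 by exact: tree_poly_neq0.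
have [zs [_ zsE ramE _ _]] := ramification_mup q0.
have qu : root (p - 1%:P) u.
  by rewrite rootE hornerD hornerN hornerC crit ?subrr // inE eqxx.
have : mup u (p - 1%:P) \in ramification p 1.
  by rewrite ramE; apply/mapP; exists u; rewrite ?zsE.
(* With [u = v] the derivative vanishes at least twice at [u], so a part at least 3 appears over 1,
   whether or not [u] is 0 or 1. *)
rewrite ram1 mup_deriv // derivB derivC subr0 (tree_poly_deriv_root_prod c uvE).
rewrite mupZ ?mulf_neq0 ?pnatr_eq0 // mup_root_prod -uv !big_cons eqxx.
by case: eqP => _; case: eqP => _; rewrite big_nil.
Qed.

Lemma tree_poly_of_passport (p : {poly R[i]}) : belyi_poly p ->
  passport p = ([:: 3; 2; 1], [:: 2; 2; 1; 1], [:: 6])%N ->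
  exists a c, belyi_iso p (tree_poly a c).
Proof.
move=> [p1 _] [ram0 _ _].
have p0 : p - 0%:P != 0 by rewrite subr0 -size_poly_gt0 (ltn_trans _ p1).
have [s [us _ sE Dp]] := ramification_factor p0.
move: sE us Dp; rewrite ram0 subr0.
case: s => [|[z0 m0] [|[z1 m1] [|[z2 m2] [|]]]] //= [-> -> ->].
rewrite !inE negb_or => /andP[/andP[z01 z02] _] Dp.
pose w := z1 - z0; have w0 : w != 0 by rewrite subr_eq0 eq_sym.
(* The substitution [w *: 'X + z0%:P] moves the roots of multiplicity 3 and 2 to 0 and 1. The power
   [w ^+ 6] comes from the degree. *)
exists ((z2 - z0) / w), (lead_coef p * w ^+ 6); exists w, z0; split=> //.
rewrite [in RHS]Dp comp_polyZ affine_root_prod // scalerA tree_poly_root_prod.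
by rewrite !big_cons big_nil /= subrr mul0r divff.
Qed.

(** An affine map preserving multiplicities must fix 0, the only triple root, and 1, the only double
    root. It is then the identity, and the simple roots agree. *)
Lemma tree_iso_inj a c a' c' :
  c != 0 -> c' != 0 -> a != 0 -> a != 1 -> a' != 0 -> a' != 1 ->
  belyi_iso (tree_poly a c) (tree_poly a' c') -> a = a'.
Proof.
move=> c0 c'0 a0 a1 a'0 a'1 [w [x [w0]]].
rewrite !tree_poly_root_prod comp_polyZ affine_root_prod // scalerA.
move=> E.
have mE z : mup z (root_prod [:: (0, 3%N); (1, 2%N); (a', 1%N)]) =
    mup z (root_prod [seq ((t.1 - x) / w, t.2)
                     | t <- [:: (0, 3%N); (1, 2%N); (a, 1%N)]]).
  rewrite -(mupZ z (root_prod _) c'0) E mupZ // mulf_neq0 // expf_neq0 //.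
have us : uniq (unzip1 [seq ((t.1 - x) / w, t.2)
                     | t <- [:: (0, 3%N); (1, 2%N); (a, 1%N)]]).
  rewrite /unzip1 -map_comp (map_comp (fun z => (z - x) / w) fst) map_inj_uniq
    //=.
    by rewrite !inE eq_sym oner_eq0 eq_sym a0 eq_sym a1.
  by move=> y y' /(mulIf (invr_neq0 w0)) /addIr.
have := mup_root_prod_uniq us; rewrite /= -!mE !mup_root_prod !big_cons
  !big_nil.
case=> m0 m1 m2.
have e0 : (0 - x) / w = 0.
  have [//|z0] := eqVneq ((0 - x) / w) 0.
  move: m0; rewrite (eq_sym 0) (negPf z0).
  have [<-|z1] := eqVneq 1 ((0 - x) / w); first by rewrite (negPf a'1).
  by case: (a' == _).
have e1 : (1 - x) / w = 1.
  have [//|z1] := eqVneq ((1 - x) / w) 1.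
  move: m1; rewrite (eq_sym 1) (negPf z1).
  have [<-|z0] := eqVneq 0 ((1 - x) / w); first by rewrite (negPf a'0).
  by case: (a' == _).
have x0 : x = 0.
  move: e0 => /eqP; rewrite mulf_eq0 invr_eq0 (negPf w0) orbF sub0r oppr_eq0.
  by move=> /eqP.
have w1 : w = 1.
  by move: e1; rewrite x0 subr0 mul1r => /(congr1 GRing.inv);
    rewrite invrK invr1.
move: m2; rewrite x0 w1 subr0 divr1 (eq_sym 0) (negPf a0) (eq_sym 1) (negPf a1).
by case: eqP.
Qed.
End TreeClassification.

(** * Automorphisms of an algebraic closure of the rationals *)

(** Factors ['X] are stripped from an annihilating polynomial until its constant term [c] is
    nonzero; then [p.[x] * x = - c] exhibits the inverse. *)
Lemma algebraic_inv_horner (F K : fieldType) (f : {rmorphism F -> K}) (x : K) :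
  algebraicOver f x -> exists h : {poly F}, x^-1 = (map_poly f h).[x].
Proof.
have [-> _|x0] := eqVneq x 0; first by exists 0; rewrite invr0 rmorph0 horner0.
case; elim/poly_ind => [|p c IH]; first by rewrite eqxx.
have [->|c0 _] := eqVneq c 0.
  rewrite polyC0 addr0 mulf_eq0 polyX_eq0 orbF rootE rmorphM /= map_polyX
    hornerMX.
  by rewrite mulf_eq0 (negPf x0) orbF; exact: IH.
rewrite rootE rmorphD rmorphM /= map_polyX map_polyC /= hornerMXaddC addr_eq0.
move=> /eqP px; exists (- c^-1 *: p).
rewrite map_polyZ hornerZ rmorphN fmorphV /=; apply: (mulIf x0).
by rewrite mulVf // -mulrA px mulrN mulNr opprK mulVf ?fmorph_eq0.
Qed.

(** Over [K] the gcd has the root [x], so it is not constant, and irreducibility makes it associate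
    to [m]. *)
Lemma irreducible_dvdp_root (F K : fieldType) (f : {rmorphism F -> K})
    (m p : {poly F}) (x : K) :
  irreducible_poly m -> root (map_poly f m) x -> root (map_poly f p) x ->
  m %| p.
Proof.
move=> [_ irr] mx px.
have gx : root (map_poly f (gcdp m p)) x by rewrite gcdp_map root_gcd mx.
have : gcdp m p %= m.
  apply: irr (dvdp_gcdl _ _).
  apply/eqP => g1; move: gx; have /size_poly1P[c c0 ->] : size (gcdp m p) == 1
    by rewrite g1.
  by rewrite map_polyC /= rootC fmorph_eq0 (negPf c0).
by move=> /eqp_dvdl <-; exact: dvdp_gcdr.
Qed.

(** This transfer of algebraic relations between two extensions makes maps of the form [p(x)] to
    [p(y)] well defined. *)
Lemma irreducible_conj_root (F K1 K2 : fieldType) (f1 : {rmorphism F -> K1})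
    (f2 : {rmorphism F -> K2}) (m p : {poly F}) (x : K1) (y : K2) :
  irreducible_poly m -> root (map_poly f1 m) x -> root (map_poly f2 m) y ->
  root (map_poly f1 p) x -> root (map_poly f2 p) y.
Proof.
move=> irr mx my px.
have /dvdpP[q ->] := irreducible_dvdp_root irr mx px.
by rewrite rmorphM /= rootM my orbT.
Qed.

(* [G] is the graph of a ring morphism defined on a subring containing the
   rationals; this subring is a field by [algebraic_inv_horner]. *)
Definition partial_hom (L : fieldType) (i : rat -> L) (G : set (L * L)) :=
  [/\ forall q, G (i q, i q), forall u v, G u -> G v -> G (u - v),
      forall u v, G u -> G v -> G (u * v) & forall y, G (0, y) -> y = 0].

Lemma mul_pairE (A B : comNzRingType) (a c : A) (b d : B) :
  (a, b) * (c, d) = (a * c, b * d).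
Proof. by []. Qed.

Section PartialHom.
Variables (L : fieldType) (i : {rmorphism rat -> L}).
Hypothesis algL : forall x : L, algebraicOver i x.
Hypothesis closedL : forall p : {poly L}, size p != 1 -> exists x, root p x.

Section Basics.
Variables (G : set (L * L)) (hG : partial_hom i G).

Lemma partial_hom_rat q : G (i q, i q).
Proof. by case: hG. Qed.

Lemma partial_hom0 : G 0.
Proof. by case: hG => /(_ 0); rewrite rmorph0. Qed.

Lemma partial_hom1 : G 1.
Proof. by case: hG => /(_ 1); rewrite rmorph1. Qed.

Lemma partial_homB u v : G u -> G v -> G (u - v).
Proof. by case: hG => _ + _ _; apply. Qed.

Lemma partial_homM u v : G u -> G v -> G (u * v).
Proof. by case: hG => _ _ + _; apply. Qed.

Lemma partial_homD u v : G u -> G v -> G (u + v).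
Proof.
move=> Gu Gv; rewrite -[v]opprK -[- v]add0r.
by apply: partial_homB => //; apply: partial_homB => //; exact: partial_hom0.
Qed.

Lemma partial_hom_fun x y z : G (x, y) -> G (x, z) -> y = z.
Proof.
case: hG => _ _ _ inj Gy Gz; apply/eqP; rewrite -subr_eq0; apply/eqP/inj.
by rewrite -(subrr x); exact: (partial_homB Gy Gz).
Qed.

Lemma partial_hom_sum n (F : nat -> L * L) :
  (forall k, G (F k)) -> G (\sum_(k < n) F k).
Proof.
by move=> GF; apply: (big_ind G) => //; [exact: partial_hom0|exact:
  partial_homD].
Qed.

Lemma partial_hom_map_horner (h : {poly rat}) x y :
  G (x, y) -> G ((map_poly i h).[x], (map_poly i h).[y]).
Proof.
move=> Gxy; elim/poly_ind: h => [|h q IHh].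
  by rewrite rmorph0 !horner0; exact: partial_hom0.
rewrite rmorphD rmorphM /= map_polyX map_polyC !hornerMXaddC /=.
apply: (@partial_homD (_, _) (_, _)); last exact: partial_hom_rat.
exact: (@partial_homM (_, _) (_, _)).
Qed.

(** The inverse of [x] is a rational polynomial in [x], and the same polynomial in [y] is its image;
    multiplying by [(x, y)] shows that this image is the inverse of [y]. At 0 the convention that 0
    is its own inverse applies. *)
Lemma partial_homV x y : G (x, y) -> G (x^-1, y^-1).
Proof.
move=> Gxy; have [h xV] := algebraic_inv_horner (algL x).
have := partial_hom_map_horner h Gxy; rewrite -xV.
have [x0|x0] := eqVneq x 0.
  have -> : y = 0 by case: hG => _ _ _; apply; rewrite -x0.
  by rewrite x0 !invr0 => _; exact: partial_hom0.
set z := _.[y] => Gz.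
have yz : z * y = 1.
  have := partial_homM Gz Gxy; rewrite mul_pairE mulVf // => G1.
  exact: partial_hom_fun G1 partial_hom1.
suff -> : y^-1 = z by [].
by rewrite -[LHS]mul1r -yz mulfK //; apply: contra_eqN yz => /eqP ->;
  rewrite mulr0 eq_sym oner_eq0.
Qed.

Lemma partial_hom_inj x : G (x, 0) -> x = 0.
Proof.
move=> Gx; apply/eqP/negPn/negP => x0.
have := partial_homM (partial_homV Gx) Gx.
rewrite mul_pairE mulVf // mulr0 => G10.
by have /eqP := partial_hom_fun G10 partial_hom1; rewrite eq_sym oner_eq0.
Qed.

(** With this symmetry, surjectivity of a maximal graph becomes totality of the reversed one. *)
Lemma partial_hom_sym : partial_hom i [set u | G (u.2, u.1)].
Proof.
split=> [q|u v|u v|y] /=; first by case: hG.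
- exact: partial_homB.
- exact: partial_homM.
- exact: partial_hom_inj.
Qed.

End Basics.

Section Extension.
Variables (G : set (L * L)) (hG : partial_hom i G).

(* [M] plays the part of the minimal polynomial of [x] over the domain of [G];
   its coefficients are pairs, so that it comes with its image under [G]. *)
Definition min_pair_poly (M : {poly L * L}) (x : L) :=
  [/\ M != 0, forall k, G M`_k, (map_poly fst M).[x] = 0 &
      forall P : {poly L * L}, P != 0 -> (forall k, G P`_k) ->
        (map_poly fst P).[x] = 0 -> (size M <= size P)%N].

Lemma min_pair_poly_exists x : exists M, min_pair_poly M x.
Proof.
pose ok (P : {poly L * L}) :=
  [/\ P != 0, forall k, G P`_k & (map_poly fst P).[x] = 0].
have [n] : exists n, `[< exists P, ok P /\ size P = n >].
  have [p p0 px] := algL x.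
  pose d (q : rat) : L * L := (i q, i q).
  pose P := \poly_(k < size p) d p`_k.
  exists (size P); apply/asboolP; exists P; split=> //; split.
  - apply/eqP => P0; case/negP: (p0); rewrite -lead_coef_eq0 lead_coefE.
    have := congr1 (fun Q : {poly L * L} => (Q`_(size p).-1).1) P0.
    rewrite coef_poly coef0 prednK ?size_poly_gt0 // leqnn /= => /eqP.
    by rewrite fmorph_eq0.
  - move=> k; rewrite coef_poly; case: ifP => _; first exact: partial_hom_rat.
    exact: partial_hom0.
  - rewrite -(rootP px); congr horner; apply/polyP => k.
    rewrite !coef_map /= coef_poly; case: ltnP => //= sk.
    by rewrite nth_default // rmorph0.
move=> exn; have exn' : exists n, `[< exists P, ok P /\ size P =
  n >] by exists n.
case: (ex_minnP exn') => {n exn exn'}n /asboolP[M [[M0 GM Mx] <-]] minM.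
exists M; split=> // P P0 GP Px; apply: minM; apply/asboolP.
by exists P.
Qed.

(** The ring [L * L] has zero divisors, but a nonzero pair in [G] has both components nonzero.
    Leading coefficients are thus invertible and Euclidean division by [M] is possible. *)
Lemma pair_poly_lead (P : {poly L * L}) :
  P != 0 -> (forall k, G P`_k) ->
  (lead_coef P).1 != 0 /\ (lead_coef P).2 != 0.
Proof.
move=> P0 GP; have := GP (size P).-1; rewrite -lead_coefE.
have := P0; rewrite -lead_coef_eq0; case: (lead_coef P) => u v /= uv0 Guv.
split; apply: contraNneq uv0 => z; rewrite z in Guv *.
  by case: hG => _ _ _ /(_ _ Guv) ->; exact/eqP.
by rewrite (partial_hom_inj hG Guv); exact/eqP.
Qed.

(** Euclidean division by [M], one leading term at a time: the multiples subtracted from [P] vanish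
    at [x] on the first side and at [y] on the second. Minimality of [M] leaves only the zero
    remainder. *)
Lemma min_pair_poly_transfer M x y (P : {poly L * L}) :
  min_pair_poly M x -> (map_poly snd M).[y] = 0 ->
  (forall k, G P`_k) -> (map_poly fst P).[x] = 0 -> (map_poly snd P).[y] = 0.
Proof.
case=> M0 GM Mx minM My; have [n] := ubnP (size P).
elim: n P => // n IHn P sP GP Px.
have [->|P0] := eqVneq P 0; first by rewrite rmorph0 horner0.
have [l1 l2] := pair_poly_lead M0 GM.
have sMP := minM P P0 GP Px.
pose w : L * L := ((lead_coef M).1^-1, (lead_coef M).2^-1).
have Gw : G w.
  apply: (partial_homV hG); rewrite -surjective_pairing; exact: GM.
have wl : w * lead_coef M = 1.
  by rewrite [lead_coef M]surjective_pairing mul_pairE !mulVf.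
pose c := lead_coef P * w; pose k := (size P - size M)%N.
pose Q := P - c *: ('X^k * M).
have sM0 : (0 < size M)%N by rewrite size_poly_gt0.
have GQ j : G Q`_j.
  rewrite coefB coefZ coefXnM; apply: (partial_homB hG) => //.
  apply: (partial_homM hG); last first.
    by case: ifP => _ //; exact: partial_hom0.
  by apply: (partial_homM hG) => //; exact: GP.
have sQ : (size Q < size P)%N.
  rewrite -[size P]prednK ?size_poly_gt0 // ltnS; apply/leq_sizeP => j.
  rewrite leq_eqVlt coefB coefZ coefXnM => /orP[/eqP <-|ltj].
    have [-> ->] : ((size P).-1 < k)%N = false /\ ((size P).-1 - k)%N =
      (size M).-1.
      by rewrite /k; move: sM0 sMP; move: (size M) (size P) => m p; lia.
    by rewrite -!lead_coefE /c -mulrA wl mulr1 subrr.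
  have sj : (size P <= j)%N by move: ltj; case: (size P).
  rewrite (nth_default _ sj); case: ifP => _; first by rewrite mulr0 subr0.
  rewrite nth_default ?mulr0 ?subr0 // /k.
  by move: sM0 sMP sj; move: (size M) (size P) => m p; lia.
have evQ (f : {rmorphism L * L -> L}) z : (map_poly f M).[z] = 0 ->
    (map_poly f Q).[z] = (map_poly f P).[z].
  move=> Mz; rewrite rmorphB /= map_polyZ [map_poly f ('X^k * M)]rmorphM /=
    hornerD hornerN
    hornerZ hornerM Mz.
  by rewrite !mulr0 subr0.
rewrite -(evQ snd) //; apply: IHn => //; first exact: leq_trans sQ sP.
by rewrite (evQ fst).
Qed.

(** The new graph is [G] with [(x, y)] adjoined as a ring. Only its last clause is not formal: a
    relation satisfied by [x] must pass to [y]. *)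
Lemma partial_hom_extend M x y :
  min_pair_poly M x -> (map_poly snd M).[y] = 0 ->
  partial_hom i [set u | exists P : {poly L * L},
                   (forall k, G P`_k) /\ u = P.[(x, y)]].
Proof.
move=> Mx My; split=> [q|_ _ [P [GP ->]] [Q [GQ ->]]|_ _ [P [GP ->]] [Q [GQ
  ->]]|z [P [GP Pz]]].
- exists (i q, i q)%:P; rewrite hornerC; split=> // k; rewrite coefC.
  by case: ifP => _; [exact: partial_hom_rat|exact: partial_hom0].
- exists (P - Q); rewrite hornerD hornerN; split=> // k; rewrite coefB.
  exact: (partial_homB hG).
- exists (P * Q); rewrite hornerM; split=> // k; rewrite coefM.
  apply: (@partial_hom_sum _ hG _ (fun j => P`_j * Q`_(k - j))) => j.
  exact: (partial_homM hG).
- have := min_pair_poly_transfer Mx My GP.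
  have ev (f : {rmorphism L * L -> L}) : (map_poly f P).[f (x, y)] =
    f P.[(x, y)].
    by rewrite horner_map.
  by rewrite (ev fst) (ev snd) -Pz /= => ->.
Qed.

Lemma partial_hom_extend_sub x y (H := [set u | exists P : {poly L * L},
                   (forall k, G P`_k) /\ u = P.[(x, y)]]) :
  G `<=` H /\ H (x, y).
Proof.
split=> [u Gu|].
  exists u%:P; rewrite hornerC; split=> // k; rewrite coefC.
  by case: ifP => _ //; exact: partial_hom0.
exists 'X; rewrite hornerX; split=> // k; rewrite coefX.
by case: (_ == _); [exact: partial_hom1|exact: partial_hom0].
Qed.

Lemma min_pair_poly_root M x : min_pair_poly M x ->
  exists y, (map_poly snd M).[y] = 0.
Proof.
case=> M0 GM Mx _; have [l1 l2] := pair_poly_lead M0 GM.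
have [|y /rootP] := closedL (p := map_poly snd M); last by exists y.
rewrite size_map_poly_id0 //; apply/eqP => M1.
have /size_poly1P[] : size (map_poly fst M) == 1 by rewrite size_map_poly_id0
  // M1.
by move=> c c0 Mc; move: Mx; rewrite Mc hornerC => /eqP; rewrite (negPf c0).
Qed.

Lemma partial_hom_extends x : exists H y, [/\ partial_hom i H, G `<=` H & H (x,
  y)].
Proof.
have [M Mx] := min_pair_poly_exists x; have [y My] := min_pair_poly_root Mx.
have [GH Hxy] := partial_hom_extend_sub x y.
by eexists; exists y; split; [exact: partial_hom_extend Mx My|exact: GH|exact:
  Hxy].
Qed.

End Extension.
End PartialHom.

Section Automorphisms.
Variables (L : fieldType) (i : {rmorphism rat -> L}).
Hypothesis algL : forall x : L, algebraicOver i x.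
Hypothesis closedL : forall p : {poly L}, size p != 1 -> exists x, root p x.

Lemma partial_hom_max (G : set (L * L)) : partial_hom i G ->
  exists A, [/\ partial_hom i A, G `<=` A &
    forall B, A `<=` B -> partial_hom i B -> B `<=` A].
Proof.
move=> hG; pose P A := A = set0 \/ (partial_hom i A /\ G `<=` A).
have chainP F : F `<=` P -> total_on F subset -> P (\bigcup_(X in F) X).
  move=> FP totF.
  have [[X0 FX0 X0n0]|allE] := pselect (exists2 X, F X & X <> set0); last first.
    left; apply/seteqP; split=> // u [X FX Xu].
    have X_0 : X = set0 by apply: contrapT => X_0; apply: allE; exists X.
    by rewrite X_0 in Xu.
  have hom X u : F X -> X u -> partial_hom i X /\ G `<=` X.
    by move=> FX Xu; case: (FP X FX) => // X_0; rewrite X_0 in Xu.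
  have [hX0 GX0] : partial_hom i X0 /\ G `<=` X0 by case: (FP X0 FX0).
  have join u v : (\bigcup_(X in F) X) u -> (\bigcup_(X in F) X) v ->
      exists X, [/\ F X, partial_hom i X, X u & X v].
    move=> [X FX Xu] [Y FY Yv]; case: (totF X Y FX FY) => [XY|YX].
      by exists Y; split=> //; [case: (hom Y v)|exact: XY].
    by exists X; split=> //; [case: (hom X u)|exact: YX].
  right; split; last by move=> u /GX0 ?; exists X0.
  split=> [q|u v Uu Uv|u v Uu Uv|y [X FX Xy]].
  - by exists X0 => //; exact: (partial_hom_rat hX0).
  - by have [X [FX hX Xu Xv]] := join u v Uu Uv; exists X => //;
      exact: (partial_homB hX).
  - by have [X [FX hX Xu Xv]] := join u v Uu Uv; exists X => //;
      exact: (partial_homM hX).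
  - by have [[_ _ _ /(_ y Xy)]] := hom X _ FX Xy.
have [A [PA maxA]] := Zorn_bigcup chainP.
have notA B : partial_hom i B -> G `<=` B -> A `<=` B -> B `<=` A.
  move=> hB GB AB; apply: contrapT => nBA; apply: (maxA B); last by right.
  by split.
case: PA => [A0|[hA GA]].
  have := notA G hG (@subset_refl _ G); rewrite A0 => /(_ (@sub0set _ _)) G0.
  by case: (G0 0); exact: (partial_hom0 hG).
by exists A; split=> // B AB hB; apply: notA => // u /GA /AB.
Qed.

(** A maximal graph absorbs every one-element extension, so it is total; applied to the reversed
    graph, the same argument makes it onto. *)
Lemma partial_hom_aut (G : set (L * L)) : partial_hom i G ->
  exists s : {rmorphism L -> L},
    bijective s /\ forall x y, G (x, y) -> s x = y.
Proof.
move=> hG; have [A [hA GA maxA]] := partial_hom_max hG.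
have totA x : exists y, A (x, y).
  have [B [y [hB AB Bxy]]] := partial_hom_extends algL closedL hA x.
  by exists y; apply: maxA Bxy.
have surA y : exists x, A (x, y).
  have hA' := partial_hom_sym algL hA.
  have [B [x [hB AB Byx]]] := partial_hom_extends algL closedL hA' y.
  exists x; apply: (maxA [set u | B (u.2, u.1)]) => //.
    by move=> [u v] Auv; exact: AB.
  exact: partial_hom_sym.
have [f Af] := choice totA; have [g Ag] := choice surA.
have fE x y : A (x, y) -> f x = y by move=> Axy;
  exact: (partial_hom_fun hA (Af x) Axy).
have fB : zmod_morphism f.
  by move=> x y; apply: fE; exact: (partial_homB hA (Af x) (Af y)).
have fM : monoid_morphism f.
  split; first by apply: fE; exact: (partial_hom1 hA).
  by move=> x y; apply: fE; exact: (partial_homM hA (Af x) (Af y)).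
pose fA := GRing.isZmodMorphism.Build _ _ f fB.
pose fMM := GRing.isMonoidMorphism.Build _ _ f fM.
pose s : {rmorphism L -> L} := HB.pack f fA fMM.
exists s; split; last by move=> x y /GA; exact: fE.
have gK : cancel g f by move=> y; apply: fE; exact: Ag.
exists g => // x; apply: (fmorph_inj s); exact: gK.
Qed.

Lemma conj_root_aut (m : {poly rat}) (x y : L) :
  irreducible_poly m -> root (map_poly i m) x -> root (map_poly i m) y ->
  exists s : {rmorphism L -> L}, bijective s /\ s x = y.
Proof.
move=> irr mx my.
pose G : set (L * L) :=
  [set u | exists p : {poly rat}, u = ((map_poly i p).[x], (map_poly i p).[y])].
have hG : partial_hom i G.
  split=> [q|_ _ [p ->] [q ->]|_ _ [p ->] [q ->]|z [p [px ->]]].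
  - by exists q%:P; rewrite map_polyC !hornerC.
  - by exists (p - q); rewrite rmorphB !hornerD !hornerN.
  - by exists (p * q); rewrite rmorphM !hornerM.
  - by apply/rootP; apply: (irreducible_conj_root irr mx my); apply/rootP.
have [s [bs sG]] := partial_hom_aut hG; exists s; split=> //.
by apply: sG; exists 'X; rewrite map_polyX !hornerX.
Qed.

Lemma closed_single_root (p : {poly L}) (x : L) :
  p != 0 -> (forall y, root p y -> y = x) ->
  p = lead_coef p *: ('X - x%:P) ^+ (size p).-1.
Proof.
have [n] := ubnP (size p); elim: n p => // n IHn p sp p0 px.
have [/eqP/size_poly1P[c c0 ->]|/closedL[y py]] := eqVneq (size p) 1.
  by rewrite size_polyC c0 lead_coefC expr0 alg_polyC.
have /factor_theorem[q Dp] : root p x by rewrite -(px y py).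
have q0 : q != 0 by apply: contra_neq p0 => q0; rewrite Dp q0 mul0r.
have sq : size p = (size q).+1 by rewrite Dp size_Mmonic ?monicXsubC //
  size_XsubC addn2.
rewrite [in LHS]Dp [in LHS](IHn q) //; first last.
- by move=> z qz; apply: px; rewrite Dp rootM qz.
- by rewrite -ltnS -sq.
rewrite sq Dp lead_coef_Mmonic ?monicXsubC // -scalerAl -exprSr.
by rewrite prednK ?size_poly_gt0.
Qed.

(* The minimal polynomial of [x] over [K] is [c *: ('X - x)^n], whose
   coefficient of degree [n - 1] is [- c * n * x]. *)
Lemma fixed_by_aut (K : set L) (x : L) :
  (forall q, K (i q)) -> (forall u v, K u -> K v -> K (u - v)) ->
  (forall u v, K u -> K v -> K (u * v)) ->
  (forall s : {rmorphism L -> L}, bijective s ->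
     (forall u, K u -> s u = u) -> s x = x) ->
  K x.
Proof.
move=> Kq KB KM fixx.
pose G : set (L * L) := [set u | K u.1 /\ u.1 = u.2].
have hG : partial_hom i G.
  split=> [q|[u _] [v _] [/= Ku <-] [/= Kv <-]|[u _] [v _] [/= Ku <-] [/= Kv
    <-]|y [/= _ <- //]].
  - by split=> //; exact: Kq.
  - by split=> //; exact: KB.
  - by split=> //; exact: KM.
have [M Mx] := min_pair_poly_exists algL hG x.
have [M0 GM Mx0 minM] := Mx; have [_ l2] := pair_poly_lead algL hG M0 GM.
pose p := map_poly snd M.
have p0 : p != 0 by rewrite -lead_coef_eq0 lead_coef_map_eq.
(* Any root [y] yields an automorphism that is the identity on [K] and sends [x] to [y], so the
   hypothesis gives [y = x]. *)
have rootp y : root p y -> y = x.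
  move=> /rootP py; have hH := partial_hom_extend algL hG Mx py.
  have [GH Hxy] := partial_hom_extend_sub hG x y.
  have [s [bs sH]] := partial_hom_aut hH.
  rewrite -(sH _ _ Hxy); apply: fixx => // u Ku; apply: sH; exact: GH.
have Kp k : K p`_k by rewrite coef_map /=; case: (GM k) => + <-.
have KV u : K u -> K u^-1.
  by move=> Ku; case: (@partial_homV _ i algL G hG u u).
have px : root p x.
  rewrite rootE -Mx0; apply/eqP; congr horner; apply/polyP => k.
  by rewrite !coef_map /=; case: (GM k).
set n := (size p).-1; have n0 : (0 < n)%N.
  by have := root_size_gt1 p0 px; rewrite /n; case: (size p) => [|[]].
have nL0 : n%:R != 0 :> L by rewrite -(rmorph_nat i) fmorph_eq0 pnatr_eq0 -lt0n.
have Kn : K n%:R by rewrite -(rmorph_nat i); exact: Kq.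
have lc0 : lead_coef p != 0 by rewrite lead_coef_eq0.
have pn : p`_n.-1 = lead_coef p * - (n%:R * x).
  rewrite {1}(closed_single_root p0 rootp) -/n coefZ; congr (_ * _).
  have := @coefPn_prod_XsubC _ (nseq n x).
  by rewrite size_nseq -lt0n n0 !big_nseq iter_mulr_1 iter_addr_0 mulr_natl =>
    ->.
have -> : x = p`_n.-1 * (lead_coef p)^-1 * (0 - n%:R)^-1.
  by rewrite pn [X in X / _]mulrAC mulfV // mul1r sub0r invrN mulrNN mulrC
    mulKf.
have K0 : K 0 by rewrite -(rmorph0 i); exact: Kq.
apply: (KM); first by apply: (KM) => //; apply: KV; exact: Kp.
by apply: KV; exact: KB.
Qed.
End Automorphisms.

(** * Algebraic numbers and subfields of the complex numbers *)

Section AlgebraicNumbers.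
Variable R : realType.

Lemma Qbar_of_rat_proof (q : rat) : ratr q \in @algebraic_number R.
Proof. by apply/asboolP; exact: algebraic_id. Qed.

Definition Qbar_of_rat (q : rat) : Qbar R := MkQbar (Qbar_of_rat_proof q).

Lemma Qbar_of_rat_zmod_morphism : zmod_morphism Qbar_of_rat.
Proof. by move=> x y; apply: val_inj; rewrite rmorphB /= rmorphB. Qed.

Lemma Qbar_of_rat_monoid_morphism : monoid_morphism Qbar_of_rat.
Proof.
split; first by apply: val_inj; rewrite rmorph1 /= rmorph1.
by move=> x y; apply: val_inj; rewrite rmorphM /= rmorphM.
Qed.

HB.instance Definition _ :=
  GRing.isZmodMorphism.Build rat (Qbar R) Qbar_of_rat Qbar_of_rat_zmod_morphism.
HB.instance Definition _ :=
  GRing.isMonoidMorphism.Build rat (Qbar R) Qbar_of_rat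
    Qbar_of_rat_monoid_morphism.

Lemma map_poly_val_rat (p : {poly rat}) :
  map_poly val (map_poly Qbar_of_rat p) = map_poly ratr p :> {poly R[i]}.
Proof. by rewrite -map_poly_comp. Qed.

Lemma Qbar_algebraic (x : Qbar R) : algebraicOver Qbar_of_rat x.
Proof.
have /asboolP[p p0 px] := Qbar_valP x; exists p => //.
by rewrite -(fmorph_root val) map_poly_val_rat.
Qed.

Lemma Qbar_root (p : {poly Qbar R}) (z : R[i]) : p != 0 ->
  root (map_poly val p) z -> z \in @algebraic_number R.
Proof.
move=> p0 pz; apply/asboolP/integral_algebraic.
apply: (integral_root _ pz); first by rewrite map_poly_eq0.
move=> y /(nthP 0)[k _ <-]; rewrite coef_map; apply/integral_algebraic.
exact/asboolP/Qbar_valP.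
Qed.

Lemma Qbar_closed (p : {poly Qbar R}) : size p != 1 -> exists x, root p x.
Proof.
have [->|p0] := eqVneq p 0; first by exists 0; exact: root0.
rewrite -(size_map_poly val) => /closed_rootP[z pz].
by exists (MkQbar (Qbar_root p0 pz)); rewrite -(fmorph_root val).
Qed.

Lemma absGal_rat (s : absGal R) (p : {poly rat}) x :
  s (map_poly Qbar_of_rat p).[x] = (map_poly Qbar_of_rat p).[s x].
Proof.
rewrite -horner_map /= -map_poly_comp; congr horner; apply: eq_map_poly => q.
by rewrite [LHS](fmorph_eq_rat (s \o Qbar_of_rat)) (fmorph_eq_rat Qbar_of_rat).
Qed.

Lemma algebraic_horner (p : {poly rat}) (z : R[i]) :
  algebraicOver (ratr : rat -> R[i]) z ->
  algebraicOver (ratr : rat -> R[i]) (map_poly ratr p).[z].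
Proof.
move=> az; elim/poly_ind: p => [|p q IHp].
  by rewrite rmorph0 horner0; exact: algebraic0.
rewrite rmorphD rmorphM /= map_polyX map_polyC hornerMXaddC /=.
by apply: algebraic_add; [exact: algebraic_mul|exact: algebraic_id].
Qed.

Lemma subfield_rat (K : set R[i]) q : is_subfield K -> K (ratr q).
Proof.
case=> K1 KB KV.
have K0 : K 0 by rewrite -(subrr 1); exact: KB.
have KN x : K x -> K (- x) by move=> Kx; rewrite -sub0r; exact: KB.
have KD x y : K x -> K y -> K (x + y).
  by move=> Kx Ky; rewrite -[y]opprK; apply: KB => //; exact: KN.
have Kn n : K n%:R by elim: n => // n IHn; rewrite -addn1 natrD; exact: KD.
have Kz (z : int) : K z%:~R.
  by case: z => n; rewrite ?NegzE ?rmorphN /=; [exact: Kn|apply: KN; exact: Kn].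
by rewrite /ratr; apply: KV.
Qed.

Lemma subfieldD (K : set R[i]) x y : is_subfield K -> K x -> K y -> K (x + y).
Proof.
case=> K1 KB _ Kx Ky; rewrite -[y]opprK; apply: (KB) => //.
by rewrite -sub0r -(subrr 1); do 2!apply: (KB) => //.
Qed.

Lemma subfieldM (K : set R[i]) x y : is_subfield K -> K x -> K y -> K (x * y).
Proof.
case=> K1 _ KV Kx Ky; rewrite -[y]invrK; apply: (KV) => //.
by rewrite -[_^-1]mul1r; exact: KV.
Qed.

Lemma subfield_horner (K : set R[i]) (p : {poly rat}) z :
  is_subfield K -> K z -> K (map_poly ratr p).[z].
Proof.
move=> hK Kz; elim/poly_ind: p => [|p q IHp].
  by rewrite rmorph0 horner0 -(rmorph0 (ratr : {rmorphism rat -> R[i]}));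
    exact: subfield_rat.
rewrite rmorphD rmorphM /= map_polyX map_polyC hornerMXaddC /=.
by apply: subfieldD => //; [exact: subfieldM|exact: subfield_rat].
Qed.

Lemma Qadjoin_subfield (z : R[i]) : is_subfield (Qadjoin z).
Proof.
split=> [|x y Kx Ky|x y Kx Ky] K [hK zK].
- by case: hK.
- by case: (hK) => _ KB _; apply: KB; [exact: Kx|exact: Ky].
- by case: (hK) => _ _ KV; apply: KV; [exact: Kx|exact: Ky].
Qed.

Lemma Qadjoin_id (z : R[i]) : Qadjoin z z.
Proof. by move=> K [_]; apply. Qed.

Lemma Qadjoin_sub (z : R[i]) (K : set R[i]) :
  is_subfield K -> K z -> Qadjoin z `<=` K.
Proof. by move=> hK Kz x Qx; apply: (Qx K); split=> // _ ->. Qed.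

Lemma QadjoinE (z : R[i]) : algebraicOver (ratr : rat -> R[i]) z ->
  Qadjoin z = [set w | exists p : {poly rat}, w = (map_poly ratr p).[z]].
Proof.
move=> az; apply/seteqP; split; last first.
  by move=> _ [p ->]; exact: (subfield_horner p (Qadjoin_subfield z)
    (@Qadjoin_id z)).
apply: Qadjoin_sub; last by exists 'X; rewrite map_polyX hornerX.
split=> [|_ _ [p ->] [q ->]|_ _ [p ->] [q ->]].
- by exists 1; rewrite rmorph1 hornerC.
- by exists (p - q); rewrite rmorphB hornerD hornerN.
(* The inverse of [q(z)] is a polynomial in [q(z)], so the polynomial expressions in [z] are closed
   under division. *)
- have [h hE] := algebraic_inv_horner (algebraic_horner q az).
  exists (p * (h \Po q)); rewrite rmorphM hornerM; congr (_ * _).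
  by rewrite /= map_comp_poly horner_comp.
Qed.

End AlgebraicNumbers.

(** * The cubic field *)

(** Separability in characteristic 0: [m] would otherwise divide its derivative, which is nonzero
    and of smaller size. *)
Lemma irreducible_deriv_root (K : fieldType) (f : {rmorphism rat -> K})
    (m : {poly rat}) (x : K) :
  irreducible_poly m -> root (map_poly f m) x ->
  ~~ root (deriv (map_poly f m)) x.
Proof.
move=> irr mx; rewrite deriv_map; apply/negP => dx.
have [m1 _] := irr; have m0 : m != 0 by rewrite -size_poly_gt0 ltnW.
have /dvdp_leq : m %| deriv m by exact: irreducible_dvdp_root irr mx dx.
rewrite leqNgt lt_size_deriv // => /(_ _)/negP[] //.
apply/eqP => /(congr1 (fun p : {poly rat} => p`_(size m).-2)) /eqP.
have -> : (deriv m)`_(size m).-2 = lead_coef m *+ (size m).-1.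
  by rewrite coef_deriv lead_coefE; case: (size m) m1 => [|[]].
rewrite coef0 mulrn_eq0 lead_coef_eq0 (negPf m0) orbF.
by case: (size m) m1 => [|[]].
Qed.

Lemma map_cubicX (A B : comNzRingType) (f : {rmorphism A -> B}) :
  map_poly f (cubic 'X) = cubic 'X.
Proof. by rewrite (rmorph_cubic (map_poly f)) /= map_polyX. Qed.

Lemma cubic_factor (K : numClosedFieldType) :
  exists2 s : seq K, uniq s & size s = 3%N /\
    cubic 'X = 25 *: \prod_(z <- s) ('X - z%:P).
Proof.
have [s Ds] := closed_field_poly_normal (cubic 'X : {poly K}).
have lc : lead_coef (cubic 'X : {poly K}) = 25.
  by rewrite lead_coefE size_cubic cubic_polyE coef_Poly.
rewrite lc in Ds; exists s; last first.
  split=> //; have := congr1 (fun p : {poly K} => size p) Ds.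
  by rewrite size_cubic size_scale ?pnatr_eq0 // size_prod_XsubC => -[].
have c0 : cubic 'X != 0 :> {poly K} by rewrite -size_poly_gt0 size_cubic.
apply/count_mem_uniq => z.
have -> : count_mem z s = mup z (cubic 'X : {poly K}).
  by rewrite Ds mupZ ?pnatr_eq0 // mu_prod_XsubC.
have zE : (z \in s) = root (cubic 'X : {poly K}) z.
  by rewrite Ds rootZ ?pnatr_eq0 // root_prod_XsubC.
rewrite zE; case: (boolP (root _ z)) => [rz|/mupNroot //].
rewrite mup_deriv // mupNroot // -(map_cubicX (ratr : {rmorphism rat -> K})).
apply: (irreducible_deriv_root cubic_irreducible_rat).
by rewrite map_cubicX.
Qed.

(** A polynomial expression in [x] is chosen for each element, and its value at [y] does not depend
    on the choice because [x] and [y] satisfy the same rational relations. *)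
Lemma root_embedding (L1 L2 : fieldType) (f1 : {rmorphism rat -> L1})
    (f2 : {rmorphism rat -> L2}) (m : {poly rat}) (x : L1) (y : L2) :
  irreducible_poly m -> root (map_poly f1 m) x -> root (map_poly f2 m) y ->
  (forall z, exists p, z = (map_poly f1 p).[x]) ->
  exists phi : {rmorphism L1 -> L2},
    forall p, phi (map_poly f1 p).[x] = (map_poly f2 p).[y].
Proof.
move=> irr mx my /choice[g gE]; pose phi z := (map_poly f2 (g z)).[y].
have phiE p : phi (map_poly f1 p).[x] = (map_poly f2 p).[y].
  apply/eqP; rewrite -subr_eq0 -hornerN -hornerD -rmorphB -rootE.
  apply: (irreducible_conj_root irr mx my).
  by rewrite rootE rmorphB hornerD hornerN -gE subrr.
have phiB : zmod_morphism phi.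
  by move=> u v; rewrite (gE u) (gE v) -hornerN -hornerD -rmorphB !phiE rmorphB
    hornerD hornerN.
have phiM : monoid_morphism phi.
  split; first by have := phiE 1; rewrite !rmorph1 !hornerC.
  by move=> u v; rewrite (gE u) (gE v) -hornerM -rmorphM !phiE rmorphM hornerM.
pose phiA := GRing.isZmodMorphism.Build _ _ phi phiB.
pose phiMM := GRing.isMonoidMorphism.Build _ _ phi phiM.
pose h : {rmorphism L1 -> L2} := HB.pack phi phiA phiMM.
by exists h.
Qed.

(** The roots of the cubic in [algC] generate a number field, in which the cubic splits. *)
Lemma cubic_splitting_field :
  exists (N : splittingFieldType rat) (x : N), root (cubic 'X) x.
Proof.
have [s us [ss sE]] := cubic_factor algC.
have [Qs [QsC [t tE genQs]]] := num_field_exists s.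
have cubE : cubic 'X = 25 *: \prod_(z <- t) ('X - z%:P) :> {poly Qs}.
  apply: (map_inj_poly (fmorph_inj QsC) (rmorph0 _)).
  rewrite map_cubicX sE map_polyZ rmorph_nat; congr (_ *: _).
  rewrite rmorph_prod -tE big_map; apply: eq_bigr => z _.
  by rewrite rmorphB /= map_polyX map_polyC.
have axQs : SplittingField.axiom Qs.
  exists (cubic 'X); first by rewrite -(map_cubicX (in_alg Qs)) alg_polyOver.
  exists t => //; rewrite cubE eqp_scale // -[25]/(25%:R).
  by rewrite -(rmorph_nat (in_alg Qs)) fmorph_eq0.
pose N : splittingFieldType rat :=
  HB.pack Qs (FieldExt_isSplittingField.Build rat Qs axQs).
case: t tE cubE {genQs} => [tE|x t _ cubE].
  by rewrite -tE in ss.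
exists N, x; rewrite [cubic _]cubE rootZ; last first.
  by rewrite -(rmorph_nat (in_alg Qs)) fmorph_eq0.
by rewrite root_prod_XsubC mem_head.
Qed.

Section CubicField.
Variables (N : splittingFieldType rat) (x : N).
Hypothesis x_root : root (cubic 'X) x.

Let F : {subfield N} := <<1; x>>%AS.

Lemma size_minPoly_cubic : size (minPoly 1 x) = 4%N.
Proof.
have /polyOver1P[q qE] := minPolyOver 1 x.
have rx : root (map_poly (in_alg N) (cubic 'X)) x by rewrite map_cubicX.
apply/eqP; rewrite eqn_leq; apply/andP; split.
  rewrite -(size_cubic rat) -(size_map_poly (in_alg N)) map_cubicX.
  apply: dvdp_leq; first by rewrite -(map_cubicX (in_alg N)) map_poly_eq0
    -size_poly_gt0 size_cubic.
  by apply: minPoly_dvdp => //; rewrite -(map_cubicX (in_alg N)) alg_polyOver.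
have qx : root (map_poly (in_alg N) q) x by rewrite -qE root_minPoly.
have := irreducible_dvdp_root cubic_irreducible_rat rx qx.
rewrite qE size_map_poly -(size_cubic rat) => /dvdp_leq; apply.
by rewrite -(map_poly_eq0 (in_alg N)) -qE monic_neq0 ?monic_minPoly.
Qed.

Lemma dim_cubic_field : \dim F = 3%N.
Proof.
by apply/eqP; rewrite dim_Fadjoin dimv1 muln1 -eqSS -size_minPoly
  size_minPoly_cubic.
Qed.

Definition cubic_field_gen : subvs_of F := Subvs (memv_adjoin 1 x).

Lemma vsval_horner (p : {poly rat}) (z : subvs_of F) :
  vsval (map_poly (in_alg (subvs_of F)) p).[z] =
  (map_poly (in_alg N) p).[vsval z].
Proof.
rewrite -horner_map /= -map_poly_comp; congr horner; apply: eq_map_poly => q.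
by rewrite (fmorph_eq_rat (in_alg N)) -(fmorph_eq_rat (@vsval _ _ F \o in_alg
  (subvs_of F))).
Qed.

Lemma cubic_field_gen_root :
  root (map_poly (in_alg (subvs_of F)) (cubic 'X)) cubic_field_gen.
Proof.
rewrite rootE; apply/eqP/val_inj; rewrite /= vsval_horner map_cubicX.
exact/rootP.
Qed.

Lemma cubic_field_gen_horner (z : subvs_of F) :
  exists p, z = (map_poly (in_alg (subvs_of F)) p).[cubic_field_gen].
Proof.
have /Fadjoin_polyP[q /polyOver1P[p ->] zE] := subvsP z.
by exists p; apply: val_inj; rewrite /= vsval_horner.
Qed.

(** Normality would split the minimal polynomial of [x] inside [F]. With a single root available
    there, it would be a cube, against separability. *)
Lemma cubic_field_not_galois :
  (forall z : subvs_of F, cubic z = 0 -> z = cubic_field_gen) ->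
  ~~ galois 1%AS F.
Proof.
move=> uniq_root; apply/negP => /and3P[_ _ /normalFieldP].
move=> /(_ x (memv_adjoin 1 x))[r /allP rF rE].
have [q qE] : exists q, cubic 'X = q * minPoly 1 x.
  apply/dvdpP/minPoly_dvdp => //.
  by rewrite -(map_cubicX (in_alg N)) alg_polyOver.
have rx b : b \in r -> b = x.
  move=> br; have /uniq_root/(congr1 val) : cubic (Subvs (rF b br)) =
    0 :> subvs_of F.
    apply: val_inj; rewrite [LHS](rmorph_cubic (@vsval _ _ F)) /= -horner_cubic.
    by apply/rootP; rewrite qE rE rootM root_prod_XsubC br orbT.
  by [].
have sr : size r = 3%N by have := size_minPoly_cubic;
  rewrite rE size_prod_XsubC => -[].
case: r sr rx rE {rF} => [|b1 [|b2 [|]]] //= b3 [] // _ rx.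
have [-> -> ->] : [/\ b1 = x, b2 = x & b3 = x].
  by split; apply: rx; rewrite !inE eqxx ?orbT.
rewrite !big_cons big_nil => rE.
have rx0 : root (map_poly (in_alg N) (cubic 'X)) x by rewrite map_cubicX.
apply: (negP (irreducible_deriv_root cubic_irreducible_rat rx0)).
rewrite map_cubicX qE rE rootE !derivM derivXsubC !(hornerXsubC, hornerD,
  hornerM).
rewrite subrr.
by rewrite !(mul0r, mulr0, addr0).
Qed.
End CubicField.

(** * Galois action on the trees *)

Lemma tree_poly_coef (R : realType) (K : set R[i]) (a c : R[i]) k :
  is_subfield K -> K a -> K c -> K (tree_poly a c)`_k.
Proof.
move=> hK Ka Kc; have [K1 KB _] := hK.
have K0 : K 0 by rewrite -(subrr 1); exact: KB.
pose P (p : {poly R[i]}) := forall k, K p`_k.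
have PM p q : P p -> P q -> P (p * q).
  move=> Pp Pq j; rewrite coefM; apply: (big_ind K) => // [x y|l _].
    exact: subfieldD.
  exact: subfieldM.
have PXB x : K x -> P ('X - x%:P).
  move=> Kx j; rewrite coefB coefX coefC; by apply: KB;
    [case: (_ == _)|case: ifP].
have PX : P 'X by move=> j; rewrite coefX; case: (_ == _).
rewrite /tree_poly coefZ; apply: subfieldM => //.
move: k; apply: (PM); last exact: PXB.
apply: (PM); first by rewrite 2!exprS expr1; apply: (PM) => //; apply: (PM).
by rewrite expr2 -polyC1; apply: (PM); exact: PXB.
Qed.

Lemma map_affine_poly (A B : nzRingType) (f : {rmorphism A -> B}) (u v : A) :
  map_poly f (u *: 'X + v%:P) = f u *: 'X + (f v)%:P.
Proof. by rewrite rmorphD /= map_polyZ map_polyX map_polyC. Qed.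

Section ConjugateTrees.
Variable R : realType.
Implicit Types (a c : Qbar R) (s : absGal R).

Lemma map_tree_poly (A B : comNzRingType) (f : {rmorphism A -> B}) (x y : A) :
  map_poly f (tree_poly x y) = tree_poly (f x) (f y).
Proof.
rewrite /tree_poly map_polyZ -polyC1 !(rmorphM, rmorphXn, rmorphB) /=.
by rewrite map_polyX !map_polyC /= rmorph1.
Qed.

(** A model over [Qbar] is related to the normal form by a substitution with complex coefficients.
    The points sent to 0 and 1 by it are roots of the model, hence algebraic; they determine the
    substitution, so [s] can be applied to it. *)
Lemma conj_treeE s a c : c != 0 ->
  conj_tree s (dessin (tree_poly (val a) (val c))) =
  dessin (tree_poly (val (s a)) (val (s c))).
Proof.
move=> c0; have vc0 : val c != 0 by rewrite fmorph_eq0.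
apply/seteqP; split=> q /=; last first.
  move=> Tq; exists (tree_poly a c); rewrite !map_tree_poly; split=> //.
  exact: belyi_iso_refl.
case=> p [[u [v [u0 pE]]] pq].
have p0 : p != 0.
  rewrite -(map_poly_eq0 val) pE -size_poly_gt0 size_affine_comp //.
  by rewrite size_tree_poly.
have rootp (z : R[i]) : z = 0 \/ z = 1 -> (z - v) / u \in @algebraic_number R.
  move=> z01; apply: (Qbar_root p0); rewrite rootE pE horner_comp.
  have -> : (u *: 'X + v%:P).[(z - v) / u] = z.
    by rewrite hornerD hornerZ hornerX hornerC mulrC divfK // subrK.
  rewrite tree_polyE.
  by case: z01 => ->; rewrite ?subrr expr0n !(mul0r, mulr0).
pose z0 := MkQbar (rootp 0 (or_introl erefl)).
pose z1 := MkQbar (rootp 1 (or_intror erefl)).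
pose u' := (z1 - z0)^-1; pose v' := - z0 * u'.
have uE : val u' = u.
  rewrite fmorphV rmorphB /= -mulrBl opprB addrA subrK subr0 mul1r invrK //.
have vE : val v' = v.
  transitivity (- val z0 * val u'); first by rewrite -rmorphN -rmorphM.
  by rewrite uE /= mulNr divfK // sub0r opprK.
have u'0 : u' != 0 by apply: contra_neq u0 => u'0; rewrite -uE u'0 rmorph0.
have pE' : p = tree_poly a c \Po (u' *: 'X + v'%:P).
  apply: (map_inj_poly val_inj (rmorph0 _)).
  rewrite map_comp_poly map_tree_poly pE; congr (_ \Po _).
  by rewrite map_affine_poly; congr (_ *: _ + _%:P);
    [exact: esym uE|exact: esym vE].
apply: belyi_iso_trans pq; exists (val (s u')), (val (s v')).
split; first by rewrite !fmorph_eq0.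
rewrite pE' !map_comp_poly !map_tree_poly; congr (_ \Po _).
by rewrite !map_affine_poly.
Qed.

End ConjugateTrees.

(** * The coefficient [c] as a function of the root [a] *)

Section Coefficient.

Definition tree_coef (K : fieldType) (a : K) : K :=
  - (93 * 10 ^+ 3 + 312) / coefE1 a.

Lemma rmorph_const_E1 (A B : nzRingType) (f : {rmorphism A -> B}) :
  f (- (93 * 10 ^+ 3 + 312)) = - (93 * 10 ^+ 3 + 312).
Proof. by rewrite !(rmorph_nat, rmorphXn, rmorphM, rmorphN, rmorphD). Qed.

Lemma rmorph_lhsE1 (A B : comNzRingType) (f : {rmorphism A -> B}) (a c : A) :
  f (lhsE1 a c) = lhsE1 (f a) (f c).
Proof.
rewrite /lhsE1 rmorphD rmorphM rmorph_coefE1; congr (_ + _).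
by rewrite !(rmorph_nat, rmorphXn, rmorphM, rmorphD).
Qed.

Lemma rmorph_tree_coef (K L : fieldType) (f : {rmorphism K -> L}) (a : K) :
  f (tree_coef a) = tree_coef (f a).
Proof.
by rewrite /tree_coef fmorph_div rmorph_coefE1 rmorph_const_E1.
Qed.

Variables (K : numFieldType) (a : K).
Hypothesis a_root : cubic a = 0.

(** The difference of the two sides is the resultant, which vanishes with the cubic. Hence the
    solution [c] of the first equation also solves the second. *)
Lemma coefE1_sqr :
  (93 * 10 ^+ 3 + 312) ^+ 2 * (a ^+ 4 * (a - 1) ^+ 3) = 432 * coefE1 a ^+ 2.
Proof.
apply/eqP; rewrite -subr_eq0; apply/eqP.
transitivity (- 432 * (25 * a ^+ 2 - 32 * a + 16) ^+ 3 * cubic a ^+ 2).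
  by rewrite /coefE1 /cubic; ring.
by rewrite a_root expr0n mulr0.
Qed.

Lemma coefE1_neq0 : coefE1 a != 0.
Proof.
have [a0 a1] := cubic_root_neq01 a_root.
apply/negP => /eqP E; have /eqP := coefE1_sqr; apply/negP.
rewrite E expr0n mulr0 mulf_neq0 ?expf_neq0 ?const_E1_neq0 //.
by rewrite mulf_neq0 ?expf_neq0 // subr_eq0.
Qed.

Lemma lhsE1_eq0 x : lhsE1 a x = 0 <-> x = tree_coef a.
Proof.
rewrite /lhsE1 /tree_coef; split=> [/eqP|->].
  rewrite addr_eq0 => /eqP <-; rewrite mulrC mulKf //; exact: coefE1_neq0.
by rewrite mulrC divfK ?addNr // coefE1_neq0.
Qed.

Lemma lhsE2_tree_coef : lhsE2 a (tree_coef a) = 0.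
Proof.
rewrite /lhsE2 /tree_coef expr_div_n sqrrN mulrA [_ * (_ ^+ 2)]mulrC coefE1_sqr.
by rewrite mulfK ?subrr // expf_neq0 // coefE1_neq0.
Qed.

Lemma tree_coef_neq0 : tree_coef a != 0.
Proof.
by rewrite mulf_neq0 ?invr_eq0 ?coefE1_neq0 // oppr_eq0 const_E1_neq0.
Qed.

End Coefficient.

(** * The real root *)

Section RealRoot.
Variable R : realType.
Let r2 : R := 2 `^ 3^-1.
Let r4 : R := 4 `^ 3^-1.
Let aR : R := (4 + 18 * r2 + 6 * r4) / 25.
Let cR : R := - (78 * 10 ^+ 3 + 125) / (1968 * r2 + 681 * r4 - 1196).

Lemma cbrt2_cube : r2 ^+ 3 = 2.
Proof.
by rewrite -powR_mulrn ?powR_ge0 // -powRrM mulVf ?pnatr_eq0 // powRr1.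
Qed.

Lemma cbrt4E : r4 = r2 ^+ 2.
Proof.
by rewrite /r4 (_ : 4 = 2 * 2) ?powRM // -natrM.
Qed.

(** Cubing the bounds is enough. Twelve decimals are kept because the denominator of [cR] multiplies
    the error by several thousand. *)
Lemma cbrt2_bounds :
  1 + 259 / 10 ^+ 3 + 921 / 10 ^+ 6 + 49 / 10 ^+ 9 + 894 / 10 ^+ 12 < r2 /\
  r2 < 1 + 259 / 10 ^+ 3 + 921 / 10 ^+ 6 + 49 / 10 ^+ 9 + 895 / 10 ^+ 12.
Proof.
have r3 := cbrt2_cube; have r0 : 0 <= r2 by exact: powR_ge0.
split; rewrite ltNge; apply/negP => h.
  have h0 : 0 <= 1 + 259 / 10 ^+ 3 + 921 / 10 ^+ 6 + 49 / 10 ^+ 9 + 894 / 10 ^+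
    12 :> R by lra.
  have := @lerXn2r R 3 _ _ r0 h0 h.
  rewrite r3; lra.
have h0 : 0 <= 1 + 259 / 10 ^+ 3 + 921 / 10 ^+ 6 + 49 / 10 ^+ 9 + 895 / 10 ^+
  12 :> R by lra.
have := @lerXn2r R 3 _ _ h0 r0 h.
rewrite r3; lra.
Qed.

Lemma cbrt4_bounds :
  (1 + 259 / 10 ^+ 3 + 921 / 10 ^+ 6 + 49 / 10 ^+ 9 + 894 / 10 ^+ 12) ^+ 2 < r4
    /\
  r4 < (1 + 259 / 10 ^+ 3 + 921 / 10 ^+ 6 + 49 / 10 ^+ 9 + 895 / 10 ^+ 12) ^+ 2.
Proof.
rewrite cbrt4E; have [l u] := cbrt2_bounds.
have sqr_mono (x y : R) : 0 <= x -> x < y -> x ^+ 2 < y ^+ 2.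
  by move=> x0 xy; rewrite ltrXn2r.
by split; apply: sqr_mono; [lra | exact: l | exact: powR_ge0 | exact: u].
Qed.

Lemma cubic_aR : cubic aR = 0.
Proof. by rewrite /cubic /aR cbrt4E; have r3 := cbrt2_cube; field: r3. Qed.

(** After division by [t - aR], completing the square in 100 times the quotient leaves a square plus
    a term that is positive as soon as [aR] exceeds 14/10. *)
Lemma cubic_real_root (t : R) : cubic t = 0 -> t = aR.
Proof.
move=> t0; apply/eqP; rewrite -subr_eq0.
have a0 : 14 / 10 < aR.
  by rewrite /aR; have [? _] := cbrt2_bounds; have [? _] := cbrt4_bounds; lra.
have pos (a Z : R) : 14 / 10 < a -> 0 <= Z ->
    Z + (1875 * a ^+ 2 - 600 * a - 2544) = 0 -> False.
  by move=> ? ? ?; have := sqr_ge0 (a - 14 / 10); nra.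
have : (t - aR) * ((50 * t + 25 * aR - 12) ^+ 2
                   + (1875 * aR ^+ 2 - 600 * aR - 2544)) = 0.
  transitivity (100 * (cubic t - cubic aR)); first by rewrite /cubic; ring.
  by rewrite t0 cubic_aR subrr mulr0.
move=> /eqP; rewrite mulf_eq0 => /orP[//|/eqP E].
by case: (pos _ _ a0 (sqr_ge0 _) E).
Qed.

Lemma aR_approx :
  `|aR - (1 + 448 / 10 ^+ 3 + 119 / 10 ^+ 6 + 408 / 10 ^+ 9)| < 5 / 10 ^+ 10.
Proof.
rewrite ltr_norml /aR; have [? ?] := cbrt2_bounds; have [? ?] := cbrt4_bounds.
by apply/andP; split; lra.
Qed.

Lemma cR_denominator_gt0 : 0 < 1968 * r2 + 681 * r4 - 1196.
Proof. by have [? _] := cbrt2_bounds; have [? _] := cbrt4_bounds; lra. Qed.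

Lemma cR_approx :
  `|cR + (33 + 40 / 10 ^+ 3 + 186 / 10 ^+ 6 + 803 / 10 ^+ 9)| < 5 / 10 ^+ 10.
Proof.
have [? ?] := cbrt2_bounds; have [? ?] := cbrt4_bounds.
have D0 := cR_denominator_gt0.
rewrite ltr_norml /cR mulNr; set x := (_ + 125) / _.
have h1 : 33 + 40 / 10 ^+ 3 + 186 / 10 ^+ 6 + 803 / 10 ^+ 9 - 5 / 10 ^+ 10 < x.
  by rewrite ltr_pdivlMr //; lra.
have h2 : x < 33 + 40 / 10 ^+ 3 + 186 / 10 ^+ 6 + 803 / 10 ^+ 9 + 5 / 10 ^+ 10.
  by rewrite ltr_pdivrMr //; lra.
by apply/andP; split; lra.
Qed.

Lemma lhsE1_aR_cR : lhsE1 aR cR = 0.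
Proof.
have D0 := lt0r_neq0 cR_denominator_gt0.
have E : coefE1 aR * (78 * 10 ^+ 3 + 125) =
    (93 * 10 ^+ 3 + 312) * (1968 * r2 + 681 * r4 - 1196).
  by rewrite /coefE1 /aR cbrt4E; have r3 := cbrt2_cube; field: r3.
by rewrite /lhsE1 /cR mulrA mulrN E mulNr mulfK // addNr.
Qed.

(** These are the coordinates of the cube root of 2 in the basis [1, aR, aR ^+ 2]; they give one
    inclusion between the two real cubic fields. *)
Lemma cbrt2_aR : r2 = 2 / 9 + 31 / 18 * aR - 25 / 36 * aR ^+ 2.
Proof. by rewrite /aR cbrt4E; have r3 := cbrt2_cube; field: r3. Qed.

End RealRoot.

(** * Fixed fields and fields of moduli *)

Section Moduli.
Variable R : realType.
Local Notation inQ := (@Qbar_of_rat R).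

Lemma cubic_algebraic (z : R[i]) : cubic z = 0 ->
  algebraicOver (ratr : rat -> R[i]) z.
Proof.
move=> z0; exists (cubic 'X); first by rewrite -size_poly_gt0 size_cubic.
by rewrite map_cubicX rootE horner_cubic z0.
Qed.

Lemma val_horner (p : {poly rat}) (x : Qbar R) :
  val (map_poly inQ p).[x] = (map_poly ratr p).[val x].
Proof. by rewrite -horner_map map_poly_val_rat. Qed.

Lemma Qadjoin_val (x : Qbar R) :
  val @^-1` Qadjoin (val x) = [set (map_poly inQ p).[x] | p in setT].
Proof.
have ax : algebraicOver (ratr : rat -> R[i]) (val x).
  exact/asboolP/Qbar_valP.
apply/seteqP; split=> [y /=|_ [p _ <-] /=]; rewrite (QadjoinE ax).
  by move=> [p yE]; exists p => //; apply: val_inj; rewrite val_horner.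
by exists p; rewrite val_horner.
Qed.

Lemma image_val_preimage (x : Qbar R) :
  val @` ((val : Qbar R -> R[i]) @^-1` Qadjoin (val x)) = Qadjoin (val x).
Proof.
have ax : algebraicOver (ratr : rat -> R[i]) (val x).
  exact/asboolP/Qbar_valP.
apply/seteqP; split=> [_ [y Ky <-]|z Kz]; first exact: Ky.
move: (Kz); rewrite [in X in X -> _](QadjoinE ax) => -[p zE].
have pE : val (map_poly inQ p).[x] = z by rewrite val_horner.
by exists (map_poly inQ p).[x]; rewrite // /preimage /= pE.
Qed.

Lemma absGal_image (s : absGal R) (x : Qbar R) :
  s @` [set (map_poly inQ p).[x] | p in setT] =
  [set (map_poly inQ p).[s x] | p in setT].
Proof.
apply/seteqP; split=> [_ [_ [p _ <-] <-]|_ [p _ <-]].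
  by exists p => //; rewrite absGal_rat.
by exists (map_poly inQ p).[x]; [exists p|rewrite absGal_rat].
Qed.

Lemma absGal_conj (x y : Qbar R) : cubic x = 0 -> cubic y = 0 ->
  exists s : absGal R, s x = y.
Proof.
move=> x0 y0.
have [s [bs sx]] : exists s : {rmorphism Qbar R ->
  Qbar R}, bijective s /\ s x = y.
  apply: (conj_root_aut (@Qbar_algebraic R) (@Qbar_closed R)
    cubic_irreducible_rat).
    by rewrite map_cubicX rootE horner_cubic x0.
  by rewrite map_cubicX rootE horner_cubic y0.
by exists (AbsGal bs).
Qed.

(** One inclusion holds because elements of Q(x) are rational polynomials in [x]; the other is
    [fixed_by_aut] for the field Q(x). *)
Lemma fixed_field_Qadjoin (x : Qbar R) :
  [set y | forall s : absGal R, s x = x -> s y = y] =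
  val @^-1` Qadjoin (val x).
Proof.
apply/seteqP; split=> [y /= fixy|]; last first.
  by rewrite Qadjoin_val => _ [p _ <-] s sx; rewrite absGal_rat sx.
have hK := Qadjoin_subfield (val x); have [_ KB _] := hK.
apply: (fixed_by_aut (@Qbar_algebraic R) (@Qbar_closed R)
  (K := [set y | Qadjoin (val x) (val y)])).
- by move=> q; exact: subfield_rat.
- by move=> u v Ku Kv; have := KB (val u) (val v) Ku Kv; rewrite -rmorphB.
- by move=> u v Ku Kv; have := @subfieldM _ _ (val u) (val v) hK Ku Kv;
    rewrite -rmorphM.
- move=> s bs fixs; apply: (fixy (AbsGal bs)) => /=.
  by apply: fixs; exact: Qadjoin_id.
Qed.

End Moduli.

Section Roots.
Variable R : realType.

Definition cubic_tree (z : R[i]) : set {poly R[i]} :=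
  dessin (tree_poly z (tree_coef z)).

Lemma belyi_cubic_tree (z : R[i]) : cubic z = 0 ->
  belyi_poly (tree_poly z (tree_coef z)) /\
  passport (tree_poly z (tree_coef z)) = ([:: 3; 2; 1], [:: 2; 2; 1;
    1], [:: 6])%N.
Proof.
move=> z0; apply: tree_passport_sufficient => //.
  exact/(lhsE1_eq0 z0).
exact: lhsE2_tree_coef.
Qed.

Lemma cubic_tree_inj (z w : R[i]) : cubic z = 0 -> cubic w = 0 ->
  cubic_tree z = cubic_tree w -> z = w.
Proof.
move=> z0 w0 /dessinP.
have [z_0 z_1] := cubic_root_neq01 z0; have [w_0 w_1] := cubic_root_neq01 w0.
exact: (tree_iso_inj (tree_coef_neq0 z0) (tree_coef_neq0 w0) z_0 z_1 w_0 w_1).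
Qed.

Lemma trees_cubic_tree :
  trees_with_passport ([:: 3; 2; 1], [:: 2; 2; 1; 1], [:: 6])%N =
  [set cubic_tree z | z in [set z : R[i] | cubic z = 0]].
Proof.
apply/seteqP; split=> [_ [p [bp pp ->]]|_ [z z0 <-]]; last first.
  by have [bz pz] := belyi_cubic_tree z0; exists (tree_poly z (tree_coef z)).
have [z [c pz]] := tree_poly_of_passport bp pp.
have bz := belyi_poly_iso pz bp.
have ppz : passport (tree_poly z c) = ([:: 3; 2; 1], [:: 2; 2; 1; 1], [:: 6])%N.
  by rewrite -pp; apply: passport_iso => //; case: bp.
have [E1 _ z0] := tree_passport_necessary bz ppz.
exists z => //; apply/esym/dessinP.
by move: E1 => /(lhsE1_eq0 z0) <-.
Qed.

Lemma cubic_Qbar (z : R[i]) : cubic z = 0 -> exists2 x : Qbar R, cubic x =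
  0 & val x = z.
Proof.
move=> z0; have Qz : z \in @algebraic_number R by apply/asboolP;
  exact: cubic_algebraic.
by exists (MkQbar Qz) => //; apply: val_inj; rewrite rmorph_cubic rmorph0.
Qed.

Lemma cubic_absGal (s : absGal R) (x : Qbar R) : cubic x = 0 -> cubic (s x) = 0.
Proof. by move=> x0; rewrite -rmorph_cubic x0 rmorph0. Qed.

Lemma cubic_val (x : Qbar R) : cubic x = 0 -> cubic (val x) = 0.
Proof. by move=> x0; rewrite -rmorph_cubic x0 rmorph0. Qed.

Lemma conj_cubic_tree (s : absGal R) (x : Qbar R) : cubic x = 0 ->
  conj_tree s (cubic_tree (val x)) = cubic_tree (val (s x)).
Proof.
move=> x0; rewrite /cubic_tree.
have -> : tree_coef (val x) = val (tree_coef x) by rewrite rmorph_tree_coef.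
have -> : tree_coef (val (s x)) = val (s (tree_coef x)).
  by rewrite !rmorph_tree_coef.
apply: conj_treeE; rewrite -(fmorph_eq0 val) rmorph_tree_coef.
exact: tree_coef_neq0 (cubic_val x0).
Qed.

Lemma galois_orbit_cubic_tree (z : R[i]) : cubic z = 0 ->
  galois_orbit (cubic_tree z) =
  [set cubic_tree w | w in [set w : R[i] | cubic w = 0]].
Proof.
move=> z0; have [x x0 <-] := cubic_Qbar z0.
apply/seteqP; split=> [_ [s _ <-]|_ [w w0 <-]].
  rewrite conj_cubic_tree //; exists (val (s x)) => //=.
  exact/cubic_val/cubic_absGal.
have [y y0 <-] := cubic_Qbar w0; have [s sx] := absGal_conj x0 y0.
by exists s => //; rewrite conj_cubic_tree // sx.
Qed.

(** The tree determines its root, so the stabilizer of the tree is the stabilizer of the root. *)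
Lemma field_of_moduli_cubic_tree (x : Qbar R) : cubic x = 0 ->
  field_of_moduli (cubic_tree (val x)) = (val : Qbar R ->
    R[i]) @^-1` Qadjoin (val x).
Proof.
move=> x0; rewrite -fixed_field_Qadjoin; apply/seteqP; split=> y /= fixy s sx.
  by apply: fixy; rewrite conj_cubic_tree // sx.
apply: fixy; move: sx; rewrite conj_cubic_tree // => /cubic_tree_inj sx.
exact: val_inj (sx (cubic_val (cubic_absGal s x0)) (cubic_val x0)).
Qed.

Lemma field_of_definition_cubic_tree (z : R[i]) :
  field_of_definition (cubic_tree z) (Qadjoin z).
Proof.
have hK := Qadjoin_subfield z; split=> //.
exists (tree_poly z (tree_coef z)); split; last exact: belyi_iso_refl.
have [_ _ KV] := hK.
have Knum : Qadjoin z (- (93 * 10 ^+ 3 + 312)).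
  have := subfield_rat (- (93 * 10 ^+ 3 + 312)) hK.
  by rewrite (rmorph_const_E1 (ratr : {rmorphism rat -> R[i]})).
have Kden : Qadjoin z (coefE1 z).
  have -> : coefE1 z = (map_poly ratr (coefE1 'X)).[z].
    rewrite (rmorph_coefE1 (map_poly (ratr : {rmorphism rat ->
      R[i]}))) /= map_polyX.
    have := rmorph_coefE1 (horner_eval z) 'X.
    by rewrite [X in _ = coefE1 X](hornerX z).
  exact: subfield_horner hK (@Qadjoin_id _ z).
by move=> k; exact: tree_poly_coef hK (@Qadjoin_id _ z) (KV _ _ Knum Kden).
Qed.

End Roots.

(** * The real root and the embeddings of the cubic field *)

Lemma horner_map_quadratic (K L : fieldType) (f : {rmorphism K -> L})
    (n k l m : K) (x : L) :
  (map_poly f (n^-1 *: (k%:P + l *: 'X + m *: 'X^2))).[x] =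
  (f n)^-1 * (f k + f l * x + f m * x ^+ 2).
Proof.
rewrite map_polyZ !rmorphD /= !map_polyZ map_polyC map_polyX map_polyXn.
by rewrite fmorphV !hornerE.
Qed.

Section RealEmbedding.
Variable R : realType.
Let r2 : R := 2 `^ 3^-1.
Let r4 : R := 4 `^ 3^-1.
Let aR : R := (4 + 18 * r2 + 6 * r4) / 25.

Lemma map_ratr_complex (p : {poly rat}) (x : R) :
  (map_poly ratr p).[x%:C] = ((map_poly ratr p).[x])%:C :> R[i].
Proof.
rewrite -(horner_map (real_complex R)) -map_poly_comp; congr horner.
by apply: eq_map_poly => q /=; rewrite fmorph_rat.
Qed.

Lemma cubic_aR_complex : cubic aR%:C = 0 :> R[i].
Proof. by rewrite -(rmorph_cubic (real_complex R)) cubic_aR rmorph0. Qed.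

Lemma cubic_root_real (x : R) : cubic x%:C = 0 :> R[i] -> x = aR.
Proof.
rewrite -(rmorph_cubic (real_complex R)) => /eqP; rewrite fmorph_eq0 => /eqP.
exact: cubic_real_root.
Qed.

(** A rational polynomial takes a real value at the real root, and there is only one real root. *)
Lemma cubic_horner_aR (p : {poly rat}) :
  cubic (map_poly ratr p).[aR%:C] = 0 :> R[i] ->
  (map_poly ratr p).[aR%:C] = aR%:C :> R[i].
Proof. by rewrite map_ratr_complex => /cubic_root_real ->. Qed.

Lemma cubic_ratr_root (z : R[i]) : cubic z = 0 ->
  root (map_poly ratr (cubic 'X)) z.
Proof. by move=> z0; rewrite map_cubicX rootE horner_cubic z0. Qed.

(* If w = p(z) for a rational polynomial p, then p also maps the real root to
   a root, which is real, hence to itself, so p is the identity on all roots. *)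
Lemma Qadjoin_cubic_inj (z w : R[i]) : cubic z = 0 -> cubic w = 0 ->
  Qadjoin z = Qadjoin w -> z = w.
Proof.
move=> z0 w0 zw; have : Qadjoin z w by rewrite zw; exact: Qadjoin_id.
rewrite (QadjoinE (cubic_algebraic z0)) => -[p wE].
have irr := cubic_irreducible_rat.
have rz := cubic_ratr_root z0; have ra := cubic_ratr_root cubic_aR_complex.
have cubic_comp (x : R[i]) :
    root (map_poly ratr (cubic 'X \Po p)) x = (cubic (map_poly ratr p).[x] ==
      0).
  by rewrite map_comp_poly map_cubicX rootE horner_comp horner_cubic.
have fix_a : (map_poly ratr p).[aR%:C] = aR%:C :> R[i].
  apply: cubic_horner_aR; apply/eqP; rewrite -cubic_comp.
  by apply: (irreducible_conj_root irr rz ra); rewrite cubic_comp -wE w0.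
have fixE (x : R[i]) : root (map_poly ratr (p - 'X)) x =
  ((map_poly ratr p).[x] == x).
  by rewrite rmorphB rootE /= map_polyX hornerD hornerN hornerX subr_eq0.
have : root (map_poly ratr (p - 'X)) z.
  by apply: (irreducible_conj_root irr ra rz); rewrite fixE fix_a.
by rewrite fixE -wE => /eqP.
Qed.

Lemma Qadjoin_aR : Qadjoin aR%:C = Qadjoin r2%:C :> set R[i].
Proof.
apply/seteqP; split; apply: Qadjoin_sub; try exact: Qadjoin_subfield.
  have -> : aR%:C = (map_poly ratr (25^-1 *: (4%:P + 18 *: 'X + 6 *:
    'X^2))).[r2%:C].
    rewrite map_ratr_complex (horner_map_quadratic (ratr : {rmorphism rat ->
      R})).
    by rewrite !rmorph_nat /aR /r4 cbrt4E mulrC.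
  exact: subfield_horner (Qadjoin_subfield _) (@Qadjoin_id _ _).
have -> : r2%:C = (map_poly ratr (36^-1 *: (8%:P + 62 *: 'X + (- 25) *:
  'X^2))).[aR%:C].
  rewrite map_ratr_complex (horner_map_quadratic (ratr : {rmorphism rat -> R})).
  have r2E : r2 = 2 / 9 + 31 / 18 * aR - 25 / 36 * aR ^+ 2 := cbrt2_aR R.
  rewrite !rmorph_nat rmorphN rmorph_nat; congr (_%:C); rewrite [LHS]r2E.
  by move: aR => a; field.
exact: subfield_horner (Qadjoin_subfield _) (@Qadjoin_id _ _).
Qed.

(** The generator [g] is a root of the cubic, so an embedding is determined by its value at [g], and
    every complex root occurs as such a value. *)
Lemma exists_cubic_field : exists (N : splittingFieldType rat) (F : {subfield
  N}),
  [/\ \dim F = 3%N, ~~ galois 1%AS F &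
    exists2 g : subvs_of F, forall f : {rmorphism subvs_of F ->
      R[i]}, cubic (f g) = 0
     & [/\ forall f : {rmorphism subvs_of F -> R[i]}, range f = Qadjoin (f g),
         forall f h : {rmorphism subvs_of F -> R[i]}, f g = h g -> f =1 h &
         forall z : R[i], cubic z = 0 ->
           exists f : {rmorphism subvs_of F -> R[i]}, f g = z]].
Proof.
have [N [x x_root]] := cubic_splitting_field.
pose F := <<1; x>>%AS; pose g := cubic_field_gen x.
exists N, F.
have g_root : root (map_poly (in_alg (subvs_of F)) (cubic 'X)) g.
  exact: cubic_field_gen_root.
have gen := cubic_field_gen_horner (x := x).
have evf (f : {rmorphism subvs_of F -> R[i]}) (p : {poly rat}) :
    f (map_poly (in_alg (subvs_of F)) p).[g] = (map_poly ratr p).[f g].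
  rewrite -horner_map -map_poly_comp; congr horner; apply: eq_map_poly => q.
  by rewrite (fmorph_eq_rat (f \o in_alg (subvs_of F))).
have cubic_g : cubic g = 0.
  by move: g_root; rewrite map_cubicX rootE horner_cubic => /eqP.
have embed (z : R[i]) : cubic z = 0 ->
    exists f : {rmorphism subvs_of F -> R[i]}, f g = z.
  move=> z0.
  have [f fE] := root_embedding cubic_irreducible_rat g_root (cubic_ratr_root
    z0) gen.
  by exists f; have := fE 'X; rewrite !map_polyX !hornerX.
have cubic_f (f : {rmorphism subvs_of F -> R[i]}) : cubic (f g) = 0.
  by rewrite -rmorph_cubic cubic_g rmorph0.
split; first exact: dim_cubic_field.
  apply: cubic_field_not_galois => // z z0.
  (* Under the embedding sending [g] to the real root, every root of the cubic in [F] becomes real,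
     hence equal to the image of [g]. *)
  have [f fg] := embed _ cubic_aR_complex.
  apply: (fmorph_inj f); have [p zE] := gen z.
  have cubic_fz : cubic (f z) = 0 by rewrite -rmorph_cubic z0 rmorph0.
  rewrite [RHS]fg; move: cubic_fz; rewrite zE evf fg; exact: cubic_horner_aR.
exists g => //; split=> // [f|f h fh z].
  rewrite (QadjoinE (cubic_algebraic (cubic_f f))).
  apply/seteqP; split=> [_ [z _ <-]|_ [p ->]].
    by have [p ->] := gen z; exists p; rewrite evf.
  by exists (map_poly (in_alg (subvs_of F)) p).[g]; rewrite ?evf.
by have [p ->] := gen z; rewrite !evf fh.
Qed.

End RealEmbedding.

Theorem theorem10p5 (R : realType) :
  let pi := ([:: 3; 2; 1], [:: 2; 2; 1; 1], [:: 6])%N in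
  let trees := @trees_with_passport R pi in
  let r2 : R := 2 `^ 3^-1 in
  let r4 : R := 4 `^ 3^-1 in
  let aR : R := (4 + 18 * r2 + 6 * r4) / 25 in
  let cR : R := - (78 * 10 ^+ 3 + 125) / (1968 * r2 + 681 * r4 - 1196) in
  (* what the two equations express *)
  (forall a c u v : R[i],
     6 *: 'X ^+ 2 - (4 + 5 * a) *: 'X + (3 * a)%:P
       = 6 *: (('X - u%:P) * ('X - v%:P)) ->
     [/\ root (deriv (tree_poly a c)) u, root (deriv (tree_poly a c)) v
       & lhsE1 a c = 0 /\ lhsE2 a c = 0 <->
         (tree_poly a c).[u] = 1 /\ (tree_poly a c).[v] = 1])
  (* elimination of c: the outer variable is c, the inner one is a *)
  /\ resultant (lhsE1 ('X%:P : {poly {poly rat}}) 'X)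
               (lhsE2 ('X%:P : {poly {poly rat}}) 'X)
     = - 432 * (25 * 'X ^+ 2 - 32 * 'X + 16) ^+ 3 * cubic 'X ^+ 2
  /\ irreducible_poly (cubic 'X : {poly rat})
  /\ (forall a c : R[i],
        belyi_poly (tree_poly a c) /\ passport (tree_poly a c) = pi <->
        [/\ lhsE1 a c = 0, lhsE2 a c = 0 & cubic a = 0])
  /\ exists (a c : 'I_3 -> R[i]),
     let T := fun i => dessin (tree_poly (a i) (c i)) in
     [/\ [/\ injective a,
             forall x, cubic x = 0 <-> exists i, x = a i,
             forall i x, lhsE1 (a i) x = 0 <-> x = c i
           & [/\ injective T, trees = range T
               & forall i, galois_orbit (T i) = trees]],
         [/\ forall i, val @` field_of_moduli (T i) = Qadjoin (a i),
             forall i, field_of_definition (T i) (Qadjoin (a i)),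
             injective (fun i => Qadjoin (a i))
           & exists (N : splittingFieldType rat) (F : {subfield N}),
             [/\ \dim F = 3%N, ~~ galois 1%AS F,
                 exists phi : 'I_3 -> {rmorphism subvs_of F -> R[i]},
                   (forall i, range (phi i) = Qadjoin (a i)) /\
                   (forall f : {rmorphism subvs_of F -> R[i]},
                      exists i, f =1 phi i)
               & exists f : {rmorphism subvs_of F -> R[i]},
                   range f = Qadjoin r2%:C]],
         forall s : absGal R,
           (exists t : 'S_3, forall i,
              conj_tree s (T i) = T (t i) /\
              [set val (s x) | x in val @^-1` Qadjoin (a i)]
                = Qadjoin (a (t i))) /\
           (forall i, field_of_moduli (conj_tree s (T i))
                        = s @` field_of_moduli (T i))
       & (exists i, [/\ a i = aR%:C, c i = cR%:C
                      & forall j, complex.Im (a j) = 0 -> j = i]) /\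
         [/\ `|aR - (1 + 448 / 10 ^+ 3 + 119 / 10 ^+ 6 + 408 / 10 ^+ 9)|
               < 5 / 10 ^+ 10
           & `|cR + (33 + 40 / 10 ^+ 3 + 186 / 10 ^+ 6 + 803 / 10 ^+ 9)|
               < 5 / 10 ^+ 10]].
Proof.
move=> pi trees r2 r4 aR cR.
split=> [a c u v E|].
  split; last exact: critical_values1 E.
    by apply: tree_poly_deriv_root E _; rewrite subrr mul0r.
  by apply: tree_poly_deriv_root E _; rewrite subrr mulr0.
split; first exact: resultant_E1_E2.
split; first exact: cubic_irreducible_rat.
split=> [a c|].
  split=> [[ba pa]|[E1 E2 a0]]; first exact: tree_passport_necessary ba pa.
  exact: tree_passport_sufficient E1 E2 a0.
have [s us [ss sE]] := cubic_factor R[i].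
pose a (i : 'I_3) : R[i] := s`_i; pose c i := tree_coef (a i).
have a_inj : injective a.
  move=> i j /eqP; rewrite nth_uniq ?ss ?ltn_ord // => /eqP; exact: val_inj.
have a_root x : cubic x = 0 <-> exists i, x = a i.
  have -> : (cubic x = 0) = (x \in s).
    rewrite -horner_cubic sE -root_prod_XsubC -(rootZ x _ (_ : 25 != 0))
      ?pnatr_eq0 //.
    by apply/propext; split=> /rootP.
  split=> [xs|[i ->]]; last by rewrite mem_nth ?ss.
  have xi : (index x s < 3)%N by rewrite -ss index_mem.
  by exists (Ordinal xi); rewrite /a nth_index.
have a0 i : cubic (a i) = 0 by apply/a_root; exists i.
have /choice[x /all_and2[x0 xa]] : forall i, exists x : Qbar R,
    cubic x = 0 /\ val x = a i.
  by move=> i; have [y] := cubic_Qbar (a0 i); exists y.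
have TE i : dessin (tree_poly (a i) (c i)) = cubic_tree (a i) by [].
have treesE : trees = range (fun i => cubic_tree (a i)).
  rewrite /trees trees_cubic_tree; apply/seteqP;
    split=> [_ [z /a_root[i ->] <-]|_ [i _ <-]].
    by exists i.
  by exists (a i) => //; exact: a0.
(* An automorphism maps roots to roots injectively, which is recorded as a permutation of the three
   indices. *)
have conj_perm (g : absGal R) : exists t : 'S_3, forall i, val (g (x i)) =
  a (t i).
  have /choice[f fE] : forall i, exists j, val (g (x i)) = a j.
    by move=> i; exact/a_root/cubic_val/cubic_absGal.
  have f_inj : injective f.
    move=> i j fij; apply: a_inj; rewrite -!xa; congr val.
    by apply: (fmorph_inj g); apply: val_inj; rewrite !fE fij.
  by exists (perm f_inj) => i; rewrite permE.
have fomE i : field_of_moduli (cubic_tree (a i)) = val @^-1` Qadjoin (a i).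
  by rewrite -xa; exact: field_of_moduli_cubic_tree.
(* The roots come in an unspecified order; [k] is the position of the real one. *)
have [k aRk] : exists k, aR%:C = a k by apply/a_root; exact: cubic_aR_complex.
exists a, c => T; split.
- split=> //; first by move=> i y; exact: lhsE1_eq0.
  split=> // [i j Tij|i].
    exact: a_inj (cubic_tree_inj (a0 i) (a0 j) Tij).
  by rewrite galois_orbit_cubic_tree // /trees trees_cubic_tree.
- split=> [i|i|i j ij|].
  + by rewrite fomE -xa image_val_preimage.
  + exact: field_of_definition_cubic_tree.
  + exact: a_inj (Qadjoin_cubic_inj (a0 i) (a0 j) ij).
  + have [N [F [dF nF [g g0 [rangeF eqF exF]]]]] := exists_cubic_field R.
    exists N, F; split=> //; last first.
      have [f fg] := exF _ (a0 k); exists f.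
      by rewrite rangeF fg -aRk; exact: Qadjoin_aR.
    have /choice[phi phiE] : forall i, exists f : {rmorphism subvs_of F ->
      R[i]},
      f g = a i by move=> i; exact: exF.
    exists phi; split=> [i|f]; first by rewrite rangeF phiE.
    have /a_root[i fi] := g0 f; exists i; apply: eqF.
    by rewrite fi phiE.
- move=> g; have [t tE] := conj_perm g.
  have conjE i : conj_tree g (T i) = T (t i).
    by rewrite /T !TE -tE -xa; exact: conj_cubic_tree.
  have imageE i : g @` (val @^-1` Qadjoin (a i)) = val @^-1` Qadjoin (a (t i)).
    by rewrite -xa -tE !Qadjoin_val absGal_image.
  split=> [|i]; last by rewrite conjE /T !TE !fomE imageE.
  exists t => i; split=> //.
  have QE j : Qadjoin (a j) = val @` ((val : Qbar R ->
    R[i]) @^-1` Qadjoin (a j)).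
    by rewrite -xa image_val_preimage.
  by rewrite [RHS]QE -imageE image_comp.
- split; last by split; [exact: aR_approx | exact: cR_approx].
  exists k; split=> //.
    apply/esym/(lhsE1_eq0 (a0 k)); rewrite -aRk.
    by rewrite -(rmorph_lhsE1 (real_complex R)) lhsE1_aR_cR rmorph0.
  move=> j aj; apply: a_inj; rewrite -aRk.
  have aE : a j = (complex.Re (a j))%:C by case: (a j) aj => ? ? /= ->.
  by rewrite aE; congr (_%:C); apply: cubic_root_real; rewrite -aE.
Qed.
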